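(* Let $(M^{16},g)$ be an oriented $16$-dimensional Riemannian manifold equipped with a $\mathrm{Spin}(9)$-structure $\mathcal{R}$ (equivalently $V^9\subset\mathrm{End}(TM^{16})$), and let $\Gamma$, a $1$-form with values in $\Lambda^3(V^9)$, be the $\mathfrak{m}$-part of the Levi-Civita connection restricted to $\mathcal{R}$. Then there exists a connection $\nabla$ preserving the $\mathrm{Spin}(9)$-structure and having totally skew-symmetric torsion if and only if the $(\mathbb{R}^{16}\oplus\mathcal{P}_3)$-part of $\Gamma$ vanishes. In this case $\Gamma$ is a usual $3$-form on $M^{16}$ (via the embedding $\Lambda^3(M^{16})\to\Lambda^1(M^{16})\otimes\Lambda^3(V^9)$ described in the context), the connection $\nabla$ is unique, and its torsion form $T$ is given by $T=-2\cdot\Gamma$.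
   Context: Algebra. $\mathbb{R}^{16}$ (oriented, Euclidean) is the real spin representation of $\mathrm{Spin}(9)$: there are linear operators $I_1,\dots,I_9:\mathbb{R}^{16}\to\mathbb{R}^{16}$ with $I_\alpha^2=\mathrm{Id}$, $I_\alpha^*=I_\alpha$, $I_\alpha I_\beta+I_\beta I_\alpha=0$ ($\alpha\ne\beta$), $\mathrm{Tr}(I_\alpha)=0$. Put $\mathbb{R}^9:=\mathrm{Lin}\{I_1,\dots,I_9\}\subset\mathrm{End}(\mathbb{R}^{16})$. Then $\mathrm{Spin}(9)=\{h\in \mathrm{SO}(16): h\,\mathbb{R}^9\,h^{-1}=\mathbb{R}^9\}$, and $\mathfrak{so}(16)=\mathfrak{spin}(9)\oplus\mathfrak{m}$ with $\mathfrak{spin}(9)=\mathrm{Lin}\{I_\alpha I_\beta:\alpha<\beta\}\cong\Lambda^2(\mathbb{R}^9)$ and $\mathfrak{m}=\mathrm{Lin}\{I_\alpha I_\beta I_\gamma:\alpha<\beta<\gamma\}\cong\Lambda^3(\mathbb{R}^9)$. The skew-symmetric operators $I_\alpha I_\beta I_\gamma$ define $2$-forms $\sigma_{\alpha\beta\gamma}(X,Y)=g(I_\alpha I_\beta I_\gamma X,Y)$. The $\mathrm{Spin}(9)$-representation $\mathbb{R}^{16}\otimes\mathfrak{m}$ splits into four pairwise inequivalent irreducible components $\mathbb{R}^{16}\oplus\mathcal{P}_1\oplus\mathcal{P}_2\oplus\mathcal{P}_3$ of dimensions $16$, $128$, $432$, $768$ respectively. Moreover $\Lambda^3(\mathbb{R}^{16})\cong\mathcal{P}_1\oplus\mathcal{P}_2$.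 Geometry. A $\mathrm{Spin}(9)$-structure on an oriented Riemannian manifold $(M^{16},g)$ is a rank-$9$ subbundle $V^9\subset\mathrm{End}(TM^{16})$ locally generated by sections $I_1,\dots,I_9$ satisfying the relations above; equivalently, a reduction $\mathcal{R}\subset\mathcal{F}(M^{16})$ of the bundle of oriented orthonormal frames to $\mathrm{Spin}(9)\subset\mathrm{SO}(16)$. Let $Z$ be the $\mathfrak{so}(16)$-valued connection form of the Levi-Civita connection on $\mathcal{F}(M^{16})$ and decompose $Z|_{T\mathcal{R}}=Z^*\oplus\Gamma$ according to $\mathfrak{so}(16)=\mathfrak{spin}(9)\oplus\mathfrak{m}$. Then $Z^*$ is a connection in $\mathcal{R}$ and $\Gamma$ is a $1$-form on $M^{16}$ with values in $\mathcal{R}\times_{\mathrm{Spin}(9)}\mathfrak{m}=\Lambda^3(V^9)$. The decomposition of $\mathbb{R}^{16}\otimes\mathfrak{m}$ induces a decomposition of $\Lambda^1(M^{16})\otimes\Lambda^3(V^9)$, hence of $\Gamma$, into its $\mathbb{R}^{16}$-, $\mathcal{P}_1$-, $\mathcal{P}_2$- and $\mathcal{P}_3$-parts. A $3$-form $\mu$ on $M^{16}$ is regarded as a section of $\Lambda^1(M^{16})\otimes\Lambda^3(V^9)$ through the embedding $$\mu\longmapsto\frac18\sum_{\alpha<\beta<\gamma}(\sigma_{\alpha\beta\gamma}\lrcorner\,\mu)\otimes I_\alpha I_\beta I_\gamma,\qquad (\sigma\lrcorner\,\mu)(X)=\sum_{i<j}\sigma(e_i,e_j)\,\mu(e_i,e_j,X)$$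 for a local orthonormal frame $(e_i)$. A connection preserving the $\mathrm{Spin}(9)$-structure is a linear connection on $TM^{16}$ that reduces to $\mathcal{R}$ (in particular it is metric). Its torsion is totally skew-symmetric if $T(X,Y,Z)=g(T(X,Y),Z)$ is a $3$-form, $T(X,Y)=\nabla_XY-\nabla_YX-[X,Y]$; then $g(\nabla_XY,Z)=g(\nabla^g_XY,Z)+\frac12T(X,Y,Z)$, where $\nabla^g$ is the Levi-Civita connection. *)

(* Defs.v *)
From mathcomp Require Import all_boot all_order all_algebra.
From mathcomp Require Import all_classical all_reals all_analysis.

Set Implicit Arguments.
Unset Strict Implicit.
Unset Printing Implicit Defensive.

Import Order.TTheory GRing.Theory Num.Theory.
Import numFieldNormedType.Exports.

Local Open Scope classical_set_scope.
Local Open Scope ring_scope.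

Section Spin9Algebra.
Context {R : realType}.
Implicit Types (I : 'I_9 -> 'M[R]_16) (h : 'M[R]_16).

Definition dotmx (x y : 'cV[R]_16) : R := (x^T *m y) 0 0.

Definition basis (a : 'I_16) : 'cV[R]_16 := delta_mx a 0.

Definition spin9_generators I : Prop :=
  [/\ forall a, I a *m I a = 1%:M,
      forall a, (I a)^T = I a,
      forall a b, a != b -> I a *m I b + I b *m I a = 0
    & forall a, \tr (I a) = 0].

Definition lin9 I : {vspace 'M[R]_16} := (\sum_(a < 9) <[I a]>)%VS.

Definition Spin9 I : set 'M[R]_16 :=
  [set h | [/\ h^T *m h = 1%:M, \det h = 1 &
    forall A : 'M[R]_16, (A \in lin9 I) = (h *m A *m h^T \in lin9 I)]].

Definition spin9 I : {vspace 'M[R]_16} :=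
  (\sum_(a < 9) \sum_(b < 9 | (a < b)%N) <[I a *m I b]>)%VS.

Definition mpart I : {vspace 'M[R]_16} :=
  (\sum_(a < 9) \sum_(b < 9 | (a < b)%N) \sum_(c < 9 | (b < c)%N)
     <[I a *m I b *m I c]>)%VS.

Definition pr_m I : 'End('M[R]_16) := daddv_pi (mpart I) (spin9 I).

(* R^16 (x) m is encoded as the linear maps R^16 -> m, identifying R^16 with  *)
(* its dual by the Euclidean product.                                        *)
Definition homtype := 'Hom('cV[R]_16, 'M[R]_16).

Definition spin9_act h (gam : homtype) : homtype :=
  linfun (fun x : 'cV[R]_16 => h *m gam (h^T *m x) *m h^T).

Definition submodule I (W : {vspace homtype}) : Prop :=
  forall h, Spin9 I h -> forall gam, gam \in W -> spin9_act h gam \in W.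

Definition irreducible_submodule I (W : {vspace homtype}) : Prop :=
  [/\ submodule I W, W != 0%VS &
      forall U : {vspace homtype}, submodule I U -> (U <= W)%VS ->
        U = 0%VS \/ U = W].

(* The four components have distinct dimensions, hence are pairwise          *)
(* inequivalent, and these data are unique.                                  *)
Record splitting I := Splitting {
  P0 : {vspace homtype};
  P1 : {vspace homtype};
  P2 : {vspace homtype};
  P3 : {vspace homtype};
  P0_irr : irreducible_submodule I P0;
  P1_irr : irreducible_submodule I P1;
  P2_irr : irreducible_submodule I P2;
  P3_irr : irreducible_submodule I P3;
  P0_dim : \dim P0 = 16%N;
  P1_dim : \dim P1 = 128%N;
  P2_dim : \dim P2 = 432%N;
  P3_dim : \dim P3 = 768%N;
  splitting_direct : directv (P0 + P1 + P2 + P3)%VS;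
  splitting_total : forall gam : homtype,
    (gam \in (P0 + P1 + P2 + P3)%VS) <-> (forall x, gam x \in mpart I) }.

Definition part03 I (S : splitting I) (gam : homtype) : homtype :=
  daddv_pi (P0 S + P3 S)%VS (P1 S + P2 S)%VS gam.

Definition sigma I (a b c : 'I_9) (x y : 'cV[R]_16) : R :=
  dotmx (I a *m I b *m I c *m x) y.

Definition contract (s : 'cV[R]_16 -> 'cV[R]_16 -> R)
    (mu : 'cV[R]_16 -> 'cV[R]_16 -> 'cV[R]_16 -> R) (x : 'cV[R]_16) : R :=
  \sum_(i < 16) \sum_(j < 16 | (i < j)%N)
    s (basis i) (basis j) * mu (basis i) (basis j) x.

Definition embed3 I (mu : 'cV[R]_16 -> 'cV[R]_16 -> 'cV[R]_16 -> R)
    (x : 'cV[R]_16) : 'M[R]_16 :=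
  8^-1 *: \sum_(a < 9) \sum_(b < 9 | (a < b)%N) \sum_(c < 9 | (b < c)%N)
    contract (sigma I a b c) mu x *: (I a *m I b *m I c).

End Spin9Algebra.

Section Manifold.
Context {R : realType}.
Notation E := 'cV[R]_16.

Fixpoint Ck_on (V : normedModType R) (k : nat) (U : set E) (f : E -> V) : Prop :=
  match k with
  | 0%N => forall x, U x -> {for x, continuous f}
  | k.+1 => (forall x, U x -> differentiable f x) /\
            forall v, Ck_on k U (fun x => 'D_v f x)
  end.

Definition smooth_on (V : normedModType R) (U : set E) (f : E -> V) : Prop :=
  forall k, Ck_on k U f.

Definition jac (f : E -> E) (x : E) : 'M[R]_16 :=
  \matrix_(a, b) ('D_(basis b) f x) a 0.

(* [cinv i] is a total function, only relevant on the image of [chart i];    *)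
(* similarly all fields on the manifold given below in the chart [i] are     *)
(* only relevant on [dom i].                                                 *)
Record oriented_manifold := OrientedManifold {
  carrier :> topologicalType;
  idx : Type;
  dom : idx -> set carrier;
  chart : idx -> carrier -> E;
  cinv : idx -> E -> carrier;
  carrier_hausdorff : hausdorff_space carrier;
  carrier_second_countable : @second_countable carrier;
  dom_open : forall i, open (dom i);
  dom_cover : forall p, exists i, dom i p;
  chart_open : forall i, open (chart i @` dom i);
  chartK : forall i p, dom i p -> cinv i (chart i p) = p;
  chart_continuous : forall i p, dom i p -> {for p, continuous (chart i)};
  cinv_continuous : forall i p, dom i p ->
    {for chart i p, continuous (cinv i)};
  transition_smooth : forall i j,
    smooth_on (chart i @` (dom i `&` dom j)) (chart j \o cinv i);
  transition_oriented : forall i j p, dom i p -> dom j p ->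
    0 < \det (jac (chart j \o cinv i) (chart i p)) }.

Variable M : oriented_manifold.

(* The change of components of tangent vectors at [p], from chart i to j. *)
Definition trans (i j : idx M) (p : M) : 'M[R]_16 :=
  jac (chart j \o cinv i) (chart i p).

Definition smooth_in (V : normedModType R) (i : idx M) (W : set M) (f : M -> V)
    : Prop :=
  smooth_on (chart i @` (W `&` dom i)) (f \o cinv i).

Definition dchart (V : normedModType R) (i : idx M) (f : M -> V) (p : M) (v : E)
    : V :=
  'D_v (f \o cinv i) (chart i p).

(* A family of k.+1 smooth vector fields on W: the columns of [X i p] are    *)
(* the components at p, in the chart i, of its members.                      *)
Definition local_fields (k : nat) (W : set M)
    (X : idx M -> M -> 'M[R]_(16, k.+1)) : Prop :=
  (forall i j p, W p -> dom i p -> dom j p -> X j p = trans i j p *m X i p) /\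
  (forall i, smooth_in i W (X i)).

Definition vector_field (W : set M) (X : idx M -> M -> E) : Prop :=
  @local_fields 0 W X.

Record metric := Metric {
  gmx :> idx M -> M -> 'M[R]_16;
  gmx_sym : forall i p, dom i p -> (gmx i p)^T = gmx i p;
  gmx_pos : forall i p, dom i p -> forall x : E, x != 0 ->
    0 < (x^T *m gmx i p *m x) 0 0;
  gmx_trans : forall i j p, dom i p -> dom j p ->
    gmx i p = (trans i j p)^T *m gmx j p *m trans i j p;
  gmx_smooth : forall i, smooth_in i (dom i) (gmx i) }.

Definition gdot (g : metric) (i : idx M) (p : M) (x y : E) : R :=
  (x^T *m gmx g i p *m y) 0 0.

(* Covariant derivatives are computed from the Christoffel matrices          *)
(* [G i p c] of the coordinate directions: nabla_v = d_v + sum_c v_c G_c.     *)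
Definition covd (G : idx M -> M -> 'I_16 -> 'M[R]_16) (k : nat) (i : idx M)
    (X : idx M -> M -> 'M[R]_(16, k.+1)) (p : M) (v : E) : 'M[R]_(16, k.+1) :=
  dchart i (X i) p v + (\sum_(c < 16) v c 0 *: G i p c) *m X i p.

Record connection := Connection {
  christoffel : idx M -> M -> 'I_16 -> 'M[R]_16;
  christoffel_smooth : forall i c,
    smooth_in i (dom i) (fun p => christoffel i p c);
  covd_trans : forall (W : set M) (X : idx M -> M -> E), open W ->
    vector_field W X -> forall i j p (v : E), W p -> dom i p -> dom j p ->
    @covd christoffel 0 j X p (trans i j p *m v)
      = trans i j p *m @covd christoffel 0 i X p v }.

Definition nabla (D : connection) (k : nat) (i : idx M)
    (X : idx M -> M -> 'M[R]_(16, k.+1)) (p : M) (v : E) : 'M[R]_(16, k.+1) :=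
  covd (christoffel D) i X p v.

Definition bracket (i : idx M) (X Y : idx M -> M -> E) (p : M) : E :=
  dchart i (Y i) p (X i p) - dchart i (X i) p (Y i p).

Definition torsion (D : connection) (i : idx M) (X Y : idx M -> M -> E) (p : M)
    : E :=
  @nabla D 0 i Y p (X i p) - @nabla D 0 i X p (Y i p) - bracket i X Y p.

Definition metric_connection (g : metric) (D : connection) : Prop :=
  forall (W : set M) (Y Z : idx M -> M -> E), open W ->
    vector_field W Y -> vector_field W Z ->
  forall i p (v : E), W p -> dom i p ->
    dchart i (fun q => gdot g i q (Y i q) (Z i q)) p v
      = gdot g i p (@nabla D 0 i Y p v) (Z i p)
        + gdot g i p (Y i p) (@nabla D 0 i Z p v).

Definition torsion_free (D : connection) : Prop :=
  forall (W : set M) (X Y : idx M -> M -> E), open W ->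
    vector_field W X -> vector_field W Y ->
  forall i p, W p -> dom i p -> torsion D i X Y p = 0.

Definition levi_civita (g : metric) (D : connection) : Prop :=
  metric_connection g D /\ torsion_free D.

Definition three_tensor := idx M -> M -> E -> E -> E -> R.

(* Linearity in the first argument and the two sign rules give trilinearity. *)
Definition three_form (mu : three_tensor) : Prop :=
  [/\ forall i p, dom i p ->
        [/\ forall (r : R) x x' y z,
              mu i p (r *: x + x') y z = r * mu i p x y z + mu i p x' y z,
            forall x y z, mu i p y x z = - mu i p x y z
          & forall x y z, mu i p x z y = - mu i p x y z],
      forall i j p, dom i p -> dom j p -> forall x y z,
        mu i p x y z =
        mu j p (trans i j p *m x) (trans i j p *m y) (trans i j p *m z)
    & forall i a b c,
        smooth_in i (dom i)
          (fun p => (mu i p (basis a) (basis b) (basis c) : R^o))].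

Definition torsion_form (g : metric) (D : connection) (T : three_tensor)
    : Prop :=
  forall (W : set M) (X Y Z : idx M -> M -> E), open W ->
    vector_field W X -> vector_field W Y -> vector_field W Z ->
  forall i p, W p -> dom i p ->
    T i p (X i p) (Y i p) (Z i p) = gdot g i p (torsion D i X Y p) (Z i p).

Definition skew_torsion (g : metric) (D : connection) : Prop :=
  exists T, three_form T /\ torsion_form g D T.

Definition same_connection (D D' : connection) : Prop :=
  forall (W : set M) (Y : idx M -> M -> E), open W -> vector_field W Y ->
  forall i p (v : E), W p -> dom i p -> @nabla D 0 i Y p v = @nabla D' 0 i Y p v.

(* A reduction of the bundle of oriented orthonormal frames to Spin(9).  A   *)
(* frame at p is given in the chart i by the matrix of its column vectors,   *)
(* on which SO(16) acts from the right.                                      *)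
Record spin9_structure (g : metric) (I : 'I_9 -> 'M[R]_16) := Spin9Structure {
  red :> idx M -> M -> set 'M[R]_16;
  red_trans : forall i j p, dom i p -> dom j p -> forall e,
    red i p e <-> red j p (trans i j p *m e);
  red_frame : forall i p, dom i p -> forall e, red i p e ->
    e^T *m gmx g i p *m e = 1%:M /\ 0 < \det e;
  red_torsor : forall i p, dom i p -> forall e, red i p e ->
    forall e', red i p e' <-> exists2 h, Spin9 I h & e' = e *m h;
  red_section : forall p, exists W e,
    [/\ open W, W p, @local_fields 15 W e &
        forall i q, W q -> dom i q -> red i q (e i q)] }.

Section Reduction.
Variables (g : metric) (I : 'I_9 -> 'M[R]_16) (S : spin9_structure g I).

Definition adapted_frame (W : set M) (e : idx M -> M -> 'M[R]_16) : Prop :=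
  [/\ open W, @local_fields 15 W e &
      forall i p, W p -> dom i p -> red S i p (e i p)].

(* The pull-back of the connection form by the local frame e:                *)
(* nabla_v e_b = sum_a (connform v)_ab e_a.                                  *)
Definition connform (D : connection) (e : idx M -> M -> 'M[R]_16) (i : idx M)
    (p : M) (v : E) : 'M[R]_16 :=
  invmx (e i p) *m @nabla D 15 i e p v.

Definition preserves (D : connection) : Prop :=
  forall W e, adapted_frame W e -> forall i p (v : E), W p -> dom i p ->
    connform D e i p v \in spin9 I.

(* The value at the frame e of Gamma, as an element of R^16 (x) m; D is      *)
(* meant to be the Levi-Civita connection.                                   *)
Definition Gamma (D : connection) (e : idx M -> M -> 'M[R]_16) (i : idx M)
    (p : M) : 'Hom('cV[R]_16, 'M[R]_16) :=
  linfun (fun x : E => pr_m I (connform D e i p (e i p *m x))).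

Definition Gamma_part03_vanishes (P : splitting I) (D : connection) : Prop :=
  forall W e, adapted_frame W e -> forall i p, W p -> dom i p ->
    part03 P (Gamma D e i p) = 0.

(* Gamma is the image of the 3-form mu; the frame e identifies the tangent   *)
(* space with R^16 and the local sections I_a of V^9 with the model ones.    *)
Definition Gamma_is (D : connection) (mu : three_tensor) : Prop :=
  forall W e, adapted_frame W e -> forall i p, W p -> dom i p ->
  forall x : E, Gamma D e i p x =
    embed3 I (fun y z t => mu i p (e i p *m y) (e i p *m z) (e i p *m t)) x.

End Reduction.
End Manifold.

Arguments oriented_manifold R : clear implicits.

(* Main.v *)
From HB Require Import structures.
Require Import Defs.
From mathcomp Require Import all_boot all_order all_algebra.
From mathcomp Require Import all_classical all_reals all_analysis.
From mathcomp Require Import zify ring lra.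

(** Write a connection as nabla = nabla^g + K.  In an adapted frame e the
    difference becomes a linear map k from R^16 to the 16 x 16 matrices,
    k(x) = e^-1 K(e x) e.  When nabla preserves the structure, k takes skew
    values, and then the torsion is a 3-form T exactly when k is alternating,
    i.e. k(x) y = - k(y) x; in that case T(x, y, z) = 2 <k(x) y, z>
    ([skew_torsion_frame]).  Moreover nabla preserves the structure exactly when
    the m-part of k(x) is - Gamma(x).  With Theta the map that takes the m-part
    of the values of an alternating map, which up to normalization is the
    embedding of 3-forms of the theorem ([embed3_pr_m]), the equation for nabla
    thus reads Theta(k) = - Gamma, at each point and frame.  It remains to show
    that Theta is injective, to identify its image, and to solve the equation
    smoothly and independently of the frame.

    Injectivity ([Theta_inj0]).  If the m-part vanishes, then
    k(x) = sum_(a < b) u_ab(x) I_a I_b.  Contracting the alternating k with the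
    symmetric matrices 1, I_c and I_c I_d I_e I_f shows that the vectors
    f_ab = I_a I_b u_ab, seen as weights on the edges of the complete graph on
    nine vertices, have sum zero over the whole graph, around each vertex and
    over each complete subgraph on four vertices.  The last family of equations
    already forces f = 0.

    Image ([Theta_imgE]).  The image of Theta is a submodule of R^16 (x) m of
    dimension 'C(16, 3) = 560, and 560 = 128 + 432 is the only way to write 560
    as a sum of some of the dimensions 16, 128, 432 and 768 of the components.
    As these are distinct, a Jordan-Hoelder argument leaves only P1 + P2.  So
    the (R^16 + P3)-part of Gamma vanishes if and only if Gamma is in the image
    of Theta.

    Geometry.  Between two adapted frames e and e' = e h, the value of Gamma
    changes by the action of h^-1: the additional term h^-1 dh lies in spin(9),
    the Lie algebra of Spin(9) ([Spin9_derive], [Gamma_gauge]).  Hence the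
    preimage of Gamma under Theta, transported back to the tangent space, does
    not depend on the frame; it gives both the 3-form mu and the connection
    nabla^g - K_mu ([exists_correction], [corrected_connection]).  Smoothness is
    checked in local frames, where e^-1 = e^T g is a polynomial expression. *)

Set Implicit Arguments.
Unset Strict Implicit.
Unset Printing Implicit Defensive.

Import Order.TTheory GRing.Theory Num.Theory.
Import numFieldNormedType.Exports.
Local Open Scope classical_set_scope.
Local Open Scope ring_scope.
Local Notation basis := Defs.basis.
Local Notation dotmx := Defs.dotmx.

(** * Linear algebra *)

Section Projections.
Context (K : fieldType) (vT : vectType K).
Implicit Types U V : {vspace vT}.

Lemma daddv_pi_eq0 U V w : (U :&: V = 0)%VS -> (w \in U + V)%VS ->
  (daddv_pi U V w == 0) = (w \in V).
Proof.
move=> dUV hw; have dVU : (V :&: U = 0)%VS by rewrite capvC.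
have e := daddv_pi_add dUV hw; apply/eqP/idP => [h|hV].
  by move: e; rewrite h add0r => <-; exact: memv_pi.
by move: e; rewrite (daddv_pi_id dVU hV) -[RHS]add0r => /addIr.
Qed.
End Projections.

Lemma linfunE (K : fieldType) (aT rT : vectType K) (f : aT -> rT) :
  linear f -> linfun f =1 f.
Proof.
move=> lf x.
pose F : {linear aT -> rT} := HB.pack f
  (GRing.isLinear.Build K aT rT *:%R f lf).
exact: (lfunE F).
Qed.

Section Lines.
Context (K : fieldType) (vT : vectType K) (T : finType).
Implicit Types (P : pred T) (F : T -> vT).

Lemma lines_coef P F (vs : T -> vT) :
  (forall t, P t -> vs t \in <[F t]>%VS) ->
  exists c : T -> K, forall t, P t -> vs t = c t *: F t.
Proof.
move=> hvs; have /choice[c hc] : forall t, exists k, P t -> vs t = k *: F t.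
  move=> t; have [/hvs/vlineP[k ->]|_] := boolP (P t); first by exists k.
  by exists 0.
by exists c.
Qed.

Lemma memv_lines P F (v : vT) :
  reflect (exists c : T -> K, v = \sum_(t | P t) c t *: F t)
          (v \in \sum_(t | P t) <[F t]>)%VS.
Proof.
apply: (iffP memv_sumP) => [[vs hvs ->]|[c ->]]; last first.
  by exists (fun t => c t *: F t) => // t _; rewrite memvZ ?memv_line.
have [c hc] := lines_coef hvs.
by exists c; apply: eq_bigr => t /hc.
Qed.
End Lines.

Section TraceForm.
Context (R : realType) (n : nat).
Implicit Types (A B : 'M[R]_n).

Definition trdot A B : R := \tr (A^T *m B).

Lemma trdotE A B : trdot A B = \sum_i \sum_j A i j * B i j.
Proof.
rewrite /trdot /mxtrace exchange_big; apply: eq_bigr => j _.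
by rewrite mxE; apply: eq_bigr => i _; rewrite mxE.
Qed.

Lemma trdotC A B : trdot A B = trdot B A.
Proof.
by rewrite !trdotE; apply: eq_bigr => i _; apply: eq_bigr => j _; rewrite mulrC.
Qed.

Lemma trdotZ A k B : trdot A (k *: B) = k * trdot A B.
Proof. by rewrite /trdot -scalemxAr linearZ. Qed.

Lemma trdot_sum A (J : finType) (Q : pred J) (B : J -> 'M[R]_n) :
  trdot A (\sum_(j | Q j) B j) = \sum_(j | Q j) trdot A (B j).
Proof. by rewrite /trdot mulmx_sumr raddf_sum. Qed.

Lemma trdot0 A : trdot A 0 = 0.
Proof. by rewrite /trdot mulmx0 linear0. Qed.

Lemma trdotB A B C : trdot A (B - C) = trdot A B - trdot A C.
Proof. by rewrite /trdot mulmxBr linearB. Qed.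

Lemma trdot_eq0 A : trdot A A = 0 -> A = 0.
Proof.
rewrite trdotE pair_big /= => h; apply/matrixP => i j; rewrite mxE; apply/eqP.
rewrite -sqrf_eq0 expr2; apply/eqP.
by apply: (psumr_eq0P _ h (i := (i, j))) => // p _; rewrite -expr2 sqr_ge0.
Qed.

Context (T : finType) (P : pred T) (F : T -> 'M[R]_n) (N : R).
Hypothesis N0 : N != 0.
Hypothesis F_orth : forall s t, P s -> P t ->
  trdot (F s) (F t) = if s == t then N else 0.

Lemma trdot_lin_comb (c : T -> R) s : P s ->
  trdot (F s) (\sum_(t | P t) c t *: F t) = N * c s.
Proof.
move=> Ps; rewrite trdot_sum (bigD1 s) //= trdotZ F_orth // eqxx.
rewrite big1 ?addr0 => [|t /andP[Pt ts]]; first by rewrite mulrC.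
by rewrite trdotZ F_orth // eq_sym (negPf ts) mulr0.
Qed.

Lemma orth_span_coord A : (A \in \sum_(t | P t) <[F t]>)%VS ->
  A = \sum_(t | P t) (N^-1 * trdot (F t) A) *: F t.
Proof.
case/memv_lines => c ->; apply: eq_bigr => t Pt.
by rewrite trdot_lin_comb // mulKf.
Qed.

(** Orthogonal vectors of nonzero norm are linearly independent, so each of them
    adds one to the dimension. *)
Lemma dim_orth_span : \dim (\sum_(t | P t) <[F t]>)%VS = #|P|.
Proof.
have /directvP /= -> : directv (\sum_(t | P t) <[F t]>)%VS.
  apply/directv_sum_independent => us hus us0 s Ps.
  have [c hc] := lines_coef hus.
  have := trdot_lin_comb c Ps.
  rewrite -(eq_bigr _ hc) us0 trdot0 => /esym/eqP.
  by rewrite mulf_eq0 (negPf N0) /= => /eqP c0; rewrite hc // c0 scale0r.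
rewrite -sum1_card; apply: eq_bigr => t Pt; rewrite dim_vline.
case: eqVneq => // Ft0; have := F_orth Pt Pt.
by rewrite eqxx Ft0 trdot0 => /esym/eqP; rewrite (negPf N0).
Qed.
End TraceForm.

(** * Increasing index tuples and skew matrices *)

Lemma card_increasing_pairs n :
  #|[pred p : 'I_n * 'I_n | (p.1 < p.2)%N]|
  = (\sum_(0 <= a < n) \sum_(0 <= b < n | (a < b)%N) 1)%N.
Proof.
rewrite -sum1_card big_mkord; under [RHS]eq_bigr do rewrite big_mkord.
by rewrite pair_big_dep; apply: eq_big => [|[]].
Qed.

Lemma card_increasing_triples n :
  #|[pred t : 'I_n * 'I_n * 'I_n | (t.1.1 < t.1.2)%N && (t.1.2 < t.2)%N]|
  = (\sum_(0 <= a < n) \sum_(0 <= b < n | (a < b)%N)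
       \sum_(0 <= c < n | (b < c)%N) 1)%N.
Proof.
rewrite -sum1_card big_mkord; under [RHS]eq_bigr do rewrite big_mkord.
rewrite pair_big_dep /=; under [RHS]eq_bigr do rewrite big_mkord.
rewrite pair_big_dep.
by apply: eq_big => [[[a b] c]|[[]]].
Qed.

Section Skew.
Context (R : realType) (n : nat).

(** Entry (i, j) of the sum receives a contribution only from the pair formed by
    i and j in increasing order. *)
Lemma skewmx_sum (A : 'M[R]_n) : A^T = - A ->
  A = \sum_(p : 'I_n * 'I_n | (p.1 < p.2)%N)
        A p.1 p.2 *: (delta_mx p.1 p.2 - delta_mx p.2 p.1).
Proof.
move=> hA; have hAij i j : A j i = - A i j.
  by move/matrixP: hA => /(_ i j); rewrite !mxE.
apply/matrixP => i j; rewrite summxE.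
have term (p : 'I_n * 'I_n) : (A p.1 p.2
  *: (delta_mx p.1 p.2 - delta_mx p.2 p.1)) i j
    = (p == (i, j))%:R * A i j + (p == (j, i))%:R * A i j.
  case: p => a b; rewrite !mxE /=.
  have -> : (i == a) && (j == b) = ((a, b) == (i, j)).
    by rewrite xpair_eqE [i == a]eq_sym [j == b]eq_sym.
  have -> : (i == b) && (j == a) = ((a, b) == (j, i)).
    by rewrite xpair_eqE [i == b]eq_sym [j == a]eq_sym andbC.
  have [[-> ->]|_] := eqVneq (a, b) (i, j); last first.
    by have [[-> ->]|_] := eqVneq (a, b) (j, i); rewrite ?[A j i]hAij /=; ring.
  have [[-> _]|_] := eqVneq (i, j) (j, i); last by rewrite /=; ring.
  by have hjj : A j j = 0 by [move: (hAij j j); lra]; rewrite hjj /=; ring.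
under eq_bigr do rewrite term.
rewrite big_split /= -!big_distrl /= -!natr_sum.
have cnt (q : 'I_n * 'I_n) : (\sum_(p : 'I_n * 'I_n | (p.1 < p.2)%N) (p == q)
  = (q.1 < q.2))%N.
  rewrite big_mkcond (bigD1 q) //= eqxx big1 ?addn0; first by case: ifP.
  by move=> p /negPf ->; case: ifP.
rewrite !cnt /=; case: ltngtP => ij /=; try ring.
have -> : A i j = 0 by move: (hAij i j); have -> : j = i by [apply/val_inj];
  move=> h; lra.
by rewrite mulr0 addr0.
Qed.

Definition skewspace : {vspace 'M[R]_n} :=
  (\sum_(p : 'I_n * 'I_n | (p.1 < p.2)%N)
    <[delta_mx p.1 p.2 - delta_mx p.2 p.1]>)%VS.

Lemma memv_skew A : reflect (A^T = - A) (A \in skewspace).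
Proof.
apply: (iffP idP) => [/memv_lines[c ->]|/skewmx_sum hA]; last first.
  by apply/memv_lines; exists (fun p => A p.1 p.2).
rewrite !linear_sum /=; apply: eq_bigr => p _.
by rewrite linearZ /= linearB /= !trmx_delta -scalerN opprB.
Qed.

Lemma dim_skew_le :
  (\dim skewspace <= #|[pred p : 'I_n * 'I_n | (p.1 < p.2)%N]|)%N.
Proof.
apply: leq_trans (dimv_leq_sum _ _ _) _; rewrite -sum1_card.
by apply: leq_sum => p _; rewrite dim_vline; case: (_ != 0).
Qed.
End Skew.

(** * Words in the generators *)

Section Words.
Context (R : realType) (I : 'I_9 -> 'M[R]_16) (hI : spin9_generators I).
Implicit Types (a b c : 'I_9) (s t : seq 'I_9).

Definition word s : 'M[R]_16 := foldr (fun a A => I a *m A) 1%:M s.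

Lemma word_cat s t : word (s ++ t) = word s *m word t.
Proof. by elim: s => [|a s IH] /=; rewrite ?mul1mx // IH mulmxA. Qed.

Lemma word1 a : word [:: a] = I a.
Proof. by rewrite /= mulmx1. Qed.

Lemma gen_sqr a : I a *m I a = 1%:M. Proof. by case: hI. Qed.
Lemma gen_sym a : (I a)^T = I a. Proof. by case: hI. Qed.
Lemma gen_anti a b : a != b -> I a *m I b = - (I b *m I a).
Proof. by case: hI => _ _ h _ /h/eqP; rewrite addr_eq0 => /eqP. Qed.

(** Moving a generator through a word costs one sign for each letter that
    differs from it. *)
Lemma gen_word c s :
  I c *m word s = (-1) ^+ count (predC1 c) s *: (word s *m I c).
Proof.
elim: s => [|a s IH] /=; first by rewrite mulmx1 mul1mx expr0 scale1r.
have [->|ac] := eqVneq a c; first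
  by rewrite add0n -[in RHS]mulmxA scalemxAr -IH.
have ca : c != a by rewrite eq_sym.
by rewrite mulmxA (gen_anti ca) mulNmx -(mulmxA (I a) (I c)) IH -scalemxAr
  !mulmxA
  exprD expr1 mulN1r scaleNr.
Qed.

Lemma trmx_word s : (word s)^T = word (rev s).
Proof.
elim: s => [|a s IH]; first by rewrite /= trmx1.
by rewrite rev_cons -cats1 word_cat word1 /= trmx_mul IH gen_sym.
Qed.

Lemma word_orthogonal s : (word s)^T *m word s = 1%:M.
Proof.
elim: s => [|a s IH] /=; first by rewrite trmx1 mulmx1.
by rewrite trmx_mul gen_sym mulmxA -(mulmxA (word s)^T) gen_sqr mulmx1.
Qed.

(** Conjugation by I_c preserves the trace but changes the sign of the word. *)
Lemma mxtrace_word0 c s : odd (count (predC1 c) s) -> \tr (word s) = 0.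
Proof.
move=> odd_s; have: \tr (I c *m word s *m I c) = - \tr (word s).
  rewrite gen_word -signr_odd odd_s expr1 scaleN1r mulNmx -mulmxA gen_sqr.
  by rewrite mulmx1 linearN.
rewrite mxtrace_mulC mulmxA gen_sqr mul1mx => /eqP.
by rewrite -addr_eq0 -mulr2n mulrn_eq0 /= => /eqP.
Qed.

Definition lt9 : rel 'I_9 := fun a b => (a < b)%N.

Lemma lt9_trans : transitive lt9.
Proof. by move=> b a c; apply: ltn_trans. Qed.

Lemma lt9_irr : irreflexive lt9.
Proof. by move=> a; rewrite /lt9 ltnn. Qed.

Lemma fresh9 s : (size s < 9)%N -> exists c, c \notin s.
Proof.
move=> hs; apply/existsP; rewrite -negb_forall; apply/negP => /forallP h.
have: (#|'I_9| <= size s)%N.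
  apply: leq_trans (card_size s); apply: subset_leq_card.
  by apply/fintype.subsetP => c _; exact: h.
by rewrite card_ord leqNgt hs.
Qed.

(** The transpose of a word is the reversed word, so this is the trace of a word
    of length less than 9. When the total length is even, a letter that belongs
    to only one of the two words makes the trace vanish; when it is odd, a
    letter outside both words does. *)
Lemma word_tr_orth s t : sorted lt9 s -> sorted lt9 t -> s != t ->
  (size s + size t < 9)%N -> \tr ((word s)^T *m word t) = 0.
Proof.
move=> ss st st_neq hsz; rewrite trmx_word -word_cat.
have cnt c : (count_mem c (rev s ++ t) + count (predC1 c) (rev s ++ t)
    = size s + size t)%N by rewrite count_predC size_cat size_rev.
have us := sorted_uniq lt9_trans lt9_irr ss.
have ut := sorted_uniq lt9_trans lt9_irr st.
have cm c : count_mem c (rev s ++ t) = ((c \in s) + (c \in t))%N.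
  by rewrite count_cat count_rev !count_uniq_mem.
have [odd_st|even_st] := boolP (odd (size s + size t)).
  have [|c] := @fresh9 (s ++ t); first by rewrite size_cat.
  rewrite mem_cat negb_or => /andP[cs ct].
  apply: (@mxtrace_word0 c); move: (cnt c).
  by rewrite cm (negPf cs) (negPf ct) add0n => ->.
have [/forallP h|] := boolP [forall c, (c \in s) == (c \in t)].
  case/eqP: st_neq; apply: (irr_sorted_eq lt9_trans lt9_irr) => // c.
  exact/eqP/h.
rewrite negb_forall => /existsP[c hc]; apply: (@mxtrace_word0 c).
have cm1 : count_mem c (rev s ++ t) = 1%N by rewrite cm; case: (c \in s) hc;
  case: (c \in t).
by move: (cnt c) even_st; rewrite cm1 => <-; rewrite /= negbK.
Qed.
End Words.

(** * Skew matrices as the orthogonal sum of spin(9) and m *)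

Section GeneratorProducts.
Context (R : realType) (I : 'I_9 -> 'M[R]_16) (hI : spin9_generators I).
Implicit Types (a b c : 'I_9) (A : 'M[R]_16).

Definition pair9 : pred ('I_9 * 'I_9) := fun p => (p.1 < p.2)%N.
Definition triple9 : pred ('I_9 * 'I_9 * 'I_9) :=
  fun t => (t.1.1 < t.1.2)%N && (t.1.2 < t.2)%N.
Definition gen2 (p : 'I_9 * 'I_9) := I p.1 *m I p.2.
Definition gen3 (t : 'I_9 * 'I_9 * 'I_9) := I t.1.1 *m I t.1.2 *m I t.2.

Lemma sum_pair9 (V : nmodType) (F : 'I_9 * 'I_9 -> V) :
  \sum_(p | pair9 p) F p = \sum_(a < 9) \sum_(b < 9 | (a < b)%N) F (a, b).
Proof. by rewrite pair_big_dep; apply: eq_big => [|[]]. Qed.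

Lemma sum_triple9 (V : nmodType) (F : 'I_9 * 'I_9 * 'I_9 -> V) :
  \sum_(t | triple9 t) F t =
  \sum_(a < 9) \sum_(b < 9 | (a < b)%N) \sum_(c < 9 | (b < c)%N) F (a, b, c).
Proof.
rewrite pair_big_dep /= pair_big_dep.
by apply: eq_big => [[[a b] c]|[[]]].
Qed.

Lemma spin9E : spin9 I = (\sum_(p | pair9 p) <[gen2 p]>)%VS.
Proof. by rewrite /spin9 pair_big_dep; apply: eq_big => [|[]]. Qed.

Lemma mpartE : mpart I = (\sum_(t | triple9 t) <[gen3 t]>)%VS.
Proof.
rewrite /mpart pair_big_dep /= pair_big_dep.
by apply: eq_big => [[[a b] c]|[[]]].
Qed.

Lemma gen2E p : gen2 p = word I [:: p.1; p.2].
Proof. by rewrite /= mulmx1. Qed.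
Lemma gen3E t : gen3 t = word I [:: t.1.1; t.1.2; t.2].
Proof. by rewrite /= mulmx1 mulmxA. Qed.

Lemma gen2_orth p q : pair9 p -> pair9 q ->
  trdot (gen2 p) (gen2 q) = if p == q then 16 else 0.
Proof.
move=> hp hq; rewrite /trdot !gen2E; case: eqVneq => [->|pq].
  by rewrite word_orthogonal // mxtrace1.
apply: word_tr_orth => //=; rewrite /lt9 ?andbT //.
by apply: contra pq => /eqP[e1 e2]; apply/eqP;
  case: p q e1 e2 {hp hq} => ? ? [? ?] /= -> ->.
Qed.

Lemma gen3_orth s t : triple9 s -> triple9 t ->
  trdot (gen3 s) (gen3 t) = if s == t then 16 else 0.
Proof.
move=> hp hq; rewrite /trdot !gen3E; case: eqVneq => [->|pq].
  by rewrite word_orthogonal // mxtrace1.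
apply: word_tr_orth => //=; rewrite /lt9 ?andbT //.
apply: contra pq => /eqP[e1 e2 e3]; apply/eqP.
by case: s t e1 e2 e3 {hp hq} => [[? ?] ?] [[? ?] ?] /= -> -> ->.
Qed.

Lemma gen2_gen3_orth p t : pair9 p -> triple9 t -> trdot (gen2 p) (gen3 t) = 0.
Proof.
move=> hp ht; rewrite /trdot gen2E gen3E.
apply: word_tr_orth => //=; rewrite /lt9 ?andbT //.
by apply/eqP => -[].
Qed.

Lemma gen2_skew p : pair9 p -> (gen2 p)^T = - gen2 p.
Proof.
move=> hp; have ne : p.2 != p.1.
  by apply/eqP => e; move: hp; rewrite /pair9 e ltnn.
by rewrite /gen2 trmx_mul !(gen_sym hI) (gen_anti hI ne).
Qed.

Lemma gen3_skew t : triple9 t -> (gen3 t)^T = - gen3 t.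
Proof.
case/andP; case: t => [[a b] c] /= ab bc;
  rewrite /gen3 /= !trmx_mul !(gen_sym hI).
have nab : b != a by apply/eqP => e; move: ab; rewrite e ltnn.
have nbc : c != b by apply/eqP => e; move: bc; rewrite e ltnn.
have nac : c != a by apply/eqP => e; move: (ltn_trans ab bc); rewrite e ltnn.
rewrite (gen_anti hI nab) mulmxN mulmxA (gen_anti hI nac) mulNmx
  -(mulmxA (I a) (I c)).
by rewrite (gen_anti hI nbc) mulmxN opprK mulmxA.
Qed.
End GeneratorProducts.

Section Spin9Decomposition.
Context (R : realType) (I : 'I_9 -> 'M[R]_16) (hI : spin9_generators I).
Implicit Types (a b c : 'I_9) (A B : 'M[R]_16).

Let N0 : (16 : R) != 0. Proof. by rewrite pnatr_eq0. Qed.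

Lemma dim_spin9 : \dim (spin9 I) = 36%N.
Proof.
rewrite spin9E (dim_orth_span N0 (@gen2_orth _ _ hI)) card_increasing_pairs.
by rewrite unlock.
Qed.

Lemma dim_mpart : \dim (mpart I) = 84%N.
Proof.
rewrite mpartE (dim_orth_span N0 (@gen3_orth _ _ hI)) card_increasing_triples.
by rewrite unlock.
Qed.

Lemma spin9_mpart_orth A B : A \in spin9 I -> B \in mpart I -> trdot A B = 0.
Proof.
rewrite spin9E mpartE => /memv_lines[c ->] /memv_lines[d ->].
rewrite trdot_sum big1 // => t ht; rewrite trdotZ trdotC trdot_sum.
rewrite big1 ?mulr0 // => p hp.
by rewrite trdotZ trdotC gen2_gen3_orth // mulr0.
Qed.

Lemma mpart_spin9_disjoint : (mpart I :&: spin9 I = 0)%VS.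
Proof.
apply/eqP; rewrite -subv0; apply/subvP => A; rewrite memv_cap memv0.
by case/andP=> hm hs; apply/eqP/trdot_eq0/spin9_mpart_orth.
Qed.

Lemma spin9_skew A : A \in spin9 I -> A^T = - A.
Proof.
rewrite spin9E => /memv_lines[c ->]; rewrite !linear_sum /=.
by apply: eq_bigr => p hp; rewrite linearZ /= gen2_skew // scalerN.
Qed.

Lemma mpart_skew A : A \in mpart I -> A^T = - A.
Proof.
rewrite mpartE => /memv_lines[c ->]; rewrite !linear_sum /=.
by apply: eq_bigr => p hp; rewrite linearZ /= gen3_skew // scalerN.
Qed.

(** The two spaces are orthogonal and have dimensions 84 and 36, while the skew
    16 x 16 matrices have dimension at most 120. *)
Lemma mpart_add_spin9 : (mpart I + spin9 I)%VS = skewspace R 16.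
Proof.
apply/eqP; rewrite -(geq_leqif (dimv_leqif_eq _)).
  rewrite dimv_disjoint_sum ?mpart_spin9_disjoint // dim_mpart dim_spin9.
  apply: leq_trans (dim_skew_le _ _) _.
  by rewrite card_increasing_pairs unlock.
by rewrite subv_add; apply/andP; split; apply/subvP => A hA; apply/memv_skew;
  [apply: mpart_skew|apply: spin9_skew].
Qed.

Lemma pr_m_spin9 A : A \in spin9 I -> pr_m I A = 0.
Proof.
move=> hA; have dj : (spin9 I :&: mpart I = 0)%VS.
  by rewrite capvC mpart_spin9_disjoint.
have hA' : A \in (mpart I + spin9 I)%VS by apply: (subvP (addvSr _ _)).
have := daddv_pi_add mpart_spin9_disjoint hA'.
have -> : daddv_pi (spin9 I) (mpart I) A = A := daddv_pi_id dj hA.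
by move=> e; apply: (addIr A); rewrite add0r.
Qed.

Lemma pr_m_mpart A : A \in mpart I -> pr_m I A = A.
Proof. exact: daddv_pi_id mpart_spin9_disjoint. Qed.

Lemma mem_pr_m A : pr_m I A \in mpart I.
Proof. exact: memv_pi. Qed.

Lemma sub_pr_m A : A^T = - A -> A - pr_m I A \in spin9 I.
Proof.
move/memv_skew; rewrite -mpart_add_spin9 => hA.
rewrite -{1}(daddv_pi_add mpart_spin9_disjoint hA) addrC addKr.
exact: memv_pi.
Qed.

Lemma pr_m_eq0 A : A^T = - A -> pr_m I A = 0 -> A \in spin9 I.
Proof. by move=> hA h; rewrite -[A]subr0 -h sub_pr_m. Qed.

(** The matrices I_a I_b I_c are orthogonal of squared norm 16, so the
    coefficients of the m-part are computed by the trace form. *)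
Lemma pr_mE A : A^T = - A ->
  pr_m I A = \sum_(t | triple9 t) (16^-1 * trdot (gen3 I t) A) *: gen3 I t.
Proof.
move=> hA; have h := mem_pr_m A.
rewrite [LHS](orth_span_coord N0 (@gen3_orth _ _ hI)) -?mpartE //.
apply: eq_bigr => t ht; congr ((_ * _) *: _); apply/eqP;
  rewrite eq_sym -subr_eq0 -trdotB.
rewrite trdotC spin9_mpart_orth ?sub_pr_m // mpartE.
by apply/memv_lines; exists (fun s => (s == t)%:R);
  rewrite (bigD1 t) //= eqxx scale1r big1
  ?addr0 // => s /andP[_ /negPf->]; rewrite scale0r.
Qed.
End Spin9Decomposition.

(** * Equivariance under Spin(9) *)

Section Adjoint.
Context (R : realType) (I : 'I_9 -> 'M[R]_16) (hI : spin9_generators I).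
Implicit Types (a b c : 'I_9) (A B h : 'M[R]_16).

Lemma lin9_sym A : A \in lin9 I -> A^T = A.
Proof.
case/memv_lines => c ->; rewrite !linear_sum /=; apply: eq_bigr => a _.
by rewrite linearZ /= gen_sym.
Qed.

Lemma gen_lin9 a : I a \in lin9 I.
Proof. by rewrite memvE; apply: (sumv_sup a). Qed.

Lemma gen2_spin9 p : pair9 p -> gen2 I p \in spin9 I.
Proof. by move=> hp; rewrite spin9E memvE; apply: (sumv_sup p). Qed.

Lemma gen_comm_spin9 a b : I a *m I b - I b *m I a \in spin9 I.
Proof.
have half (c d : 'I_9) : (c < d)%N -> I c *m I d - I d *m I c \in spin9 I.
  move=> cd; have h := gen2_spin9 (p := (c, d)) cd.
  rewrite -{2}(gen_sym hI c) -{2}(gen_sym hI d) -trmx_mul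
    -[I c *m I d]/(gen2 I (c, d)).
  by rewrite (gen2_skew hI (p := (c, d)) cd) opprK rpredD.
case: (ltngtP a b) => [/half//|/half|/val_inj->]; last by rewrite subrr mem0v.
by rewrite -memvN opprB.
Qed.

(** The diagonal terms of the bilinear expansion cancel, which leaves only the
    products of two distinct generators. *)
Lemma lin9_comm_spin9 A B :
  A \in lin9 I -> B \in lin9 I -> A *m B - B *m A \in spin9 I.
Proof.
case/memv_lines => c ->; case/memv_lines => d ->.
rewrite mulmx_suml mulmx_sumr -sumrB rpred_sum // => a _.
rewrite -scalemxAl -scalemxAr -scalerBr memvZ //.
rewrite mulmx_sumr mulmx_suml -sumrB rpred_sum // => b _.
by rewrite -scalemxAl -scalemxAr -scalerBr memvZ // gen_comm_spin9.
Qed.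

Section Conj.
Context (h : 'M[R]_16) (hh : Spin9 I h).

Lemma Spin9_trl : h^T *m h = 1%:M. Proof. by case: hh. Qed.
Lemma Spin9_trr : h *m h^T = 1%:M. Proof. exact/mulmx1C/Spin9_trl. Qed.

Lemma Spin9_tr : Spin9 I h^T.
Proof.
case: hh => h1 h2 h3; split; rewrite ?trmxK ?det_tr ?Spin9_trr // => A.
by rewrite [RHS]h3 !mulmxA Spin9_trr mul1mx -mulmxA Spin9_trr mulmx1.
Qed.

Lemma Ad_mul A B : h *m (A *m B) *m h^T = (h *m A *m h^T) *m (h *m B *m h^T).
Proof. by rewrite !mulmxA -(mulmxA _ h^T h) Spin9_trl mulmx1. Qed.

Lemma Ad_tr A : (h *m A *m h^T)^T = h *m A^T *m h^T.
Proof. by rewrite !trmx_mul trmxK mulmxA. Qed.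

(** A conjugate of I_a I_b is a product of two elements of lin9 that is skew,
    hence half of a commutator of elements of lin9. *)
Lemma Ad_spin9 A : A \in spin9 I -> h *m A *m h^T \in spin9 I.
Proof.
have Adlin a : h *m I a *m h^T \in lin9 I by case: hh => _ _ <-;
  exact: gen_lin9.
rewrite spin9E => /memv_lines[c ->]; rewrite -spin9E mulmx_sumr mulmx_suml.
rewrite rpred_sum // => p hp; rewrite -scalemxAr -scalemxAl memvZ //.
have hX : (h *m gen2 I p *m h^T)^T = - (h *m gen2 I p *m h^T).
  by rewrite Ad_tr gen2_skew // mulmxN mulNmx.
suff : (2 : R) *: (h *m gen2 I p *m h^T) \in spin9 I.
  have e2 : (2^-1 : R) * 2 = 1 by field.
  by move/(memvZ (2^-1 : R)); rewrite scalerA e2 scale1r.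
rewrite scaler_nat mulr2n -{2}[h *m _ *m _]opprK -hX.
rewrite /gen2 Ad_mul trmx_mul !(lin9_sym (Adlin _)).
exact: lin9_comm_spin9.
Qed.
End Conj.

(** Since skew matrices are the orthogonal sum of m and spin(9), m is the
    orthogonal complement of spin(9). This description makes the invariance of m
    a consequence of that of spin(9). *)
Lemma mpartP A : A^T = - A -> (forall B, B \in spin9 I -> trdot B A = 0) ->
  A \in mpart I.
Proof.
move=> hA horth; suff: A - pr_m I A = 0.
  by move/eqP; rewrite subr_eq0 => /eqP->; exact: mem_pr_m.
apply: trdot_eq0; have hs := sub_pr_m hI hA.
by rewrite trdotB horth // (spin9_mpart_orth hI hs (mem_pr_m _ _)) subr0.
Qed.

Lemma Ad_mpart h A : Spin9 I h -> A \in mpart I -> h *m A *m h^T \in mpart I.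
Proof.
move=> hh hA; apply: mpartP => [|B hB].
  by rewrite Ad_tr (mpart_skew hI hA) mulmxN mulNmx.
have hB' := Ad_spin9 (Spin9_tr hh) hB; rewrite trmxK in hB'.
rewrite -[RHS](spin9_mpart_orth hI hB' hA) /trdot !mulmxA mxtrace_mulC !trmx_mul
  !trmxK.
by rewrite !mulmxA.
Qed.

Lemma pr_m_Ad h A : Spin9 I h -> A^T = - A ->
  pr_m I (h *m A *m h^T) = h *m pr_m I A *m h^T.
Proof.
move=> hh hA; have hs := Ad_spin9 hh (sub_pr_m hI hA).
have -> : h *m A *m h^T = h *m (A - pr_m I A) *m h^T + h *m pr_m I A *m h^T.
  by rewrite mulmxBr mulmxBl subrK.
by rewrite linearD /= pr_m_spin9 // add0r pr_m_mpart // Ad_mpart // mem_pr_m.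
Qed.
End Adjoint.

Section Theta.
Context (R : realType) (I : 'I_9 -> 'M[R]_16) (hI : spin9_generators I).
Local Notation E := 'cV[R]_16.
Implicit Types (gam : @homtype R) (h : 'M[R]_16).

(** The encoding of a 3-form mu on R^16 as the linear map gam with mu(x, y, z) =
    <gam(z) x, y>. *)
Definition alternating3 gam : Prop :=
  (forall x, (gam x)^T = - gam x) /\ (forall x y, gam x *m y = - (gam y *m x)).

(** On 3-forms, this is the embedding into R^16 (x) m: the coefficient 1/8
    sum_(i < j) of the embedding is the coordinate of the m-part on the
    orthogonal family of the I_a I_b I_c. *)
Definition Theta gam : homtype := (pr_m I \o gam)%VF.

Lemma ThetaE gam x : Theta gam x = pr_m I (gam x).
Proof. exact: comp_lfunE. Qed.

Lemma spin9_actE h gam x : spin9_act h gam x = h *m gam (h^T *m x) *m h^T.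
Proof.
rewrite /spin9_act linfunE // => k y z.
by rewrite mulmxDr -scalemxAr linearP /= mulmxDr mulmxDl -scalemxAr -scalemxAl.
Qed.

Lemma spin9_act_linear h : linear (spin9_act h).
Proof.
move=> k x y; apply/lfunP => z; rewrite add_lfunE scale_lfunE !spin9_actE.
by rewrite add_lfunE scale_lfunE mulmxDr mulmxDl -scalemxAr -scalemxAl.
Qed.

Lemma Theta_act h gam : Spin9 I h -> alternating3 gam ->
  Theta (spin9_act h gam) = spin9_act h (Theta gam).
Proof.
move=> hh [hg _]; apply/lfunP => x.
by rewrite ThetaE !spin9_actE pr_m_Ad // ThetaE.
Qed.

Lemma alternating3_act h gam : Spin9 I h -> alternating3 gam ->
  alternating3 (spin9_act h gam).
Proof.
move=> hh [hg1 hg2]; split=> [x|x y]; rewrite !spin9_actE.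
  by rewrite Ad_tr hg1 mulmxN mulNmx.
by rewrite -!mulmxA hg2 mulmxN.
Qed.
End Theta.

(** * A 3-form with values in spin(9) vanishes *)

Section EdgeWeights.
Context (R : realFieldType) (F : 'I_9 -> 'I_9 -> R).
Hypothesis F_sym : forall a b, F a b = F b a.
Hypothesis F_diag : forall a, F a a = 0.

(** The inclusion matrix between edges and 4-subsets of a 6-element set is
    square of size 15 and invertible; six vertices that contain a and b
    therefore suffice. *)
Lemma K4_sums_zero :
  (forall a b c d, uniq [:: a; b; c; d] ->
     F a b + F a c + F a d + F b c + F b d + F c d = 0) ->
  forall a b, F a b = 0.
Proof.
move=> K4 a b; have [->//|ab] := eqVneq a b.
have u0 : uniq [:: b; a] by rewrite /= inE eq_sym ab.
have [c uc] := @fresh9 [:: b; a] isT.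
have [d ud] := @fresh9 [:: c; b; a] isT.
have [e ue] := @fresh9 [:: d; c; b; a] isT.
have [f uf] := @fresh9 [:: e; d; c; b; a] isT.
have u1 : uniq [:: f; e; d; c; b; a]
  by rewrite cons_uniq uf cons_uniq ue cons_uniq ud cons_uniq uc.
have sub m : uniq (mask m [:: f; e; d; c; b; a]) by apply: mask_uniq.
(* One equation for each of the fifteen 4-subsets of the six letters. *)
have h1 := K4 _ _ _ _ (sub [:: false; false; true; true; true; true]).
have h2 := K4 _ _ _ _ (sub [:: false; true; false; true; true; true]).
have h3 := K4 _ _ _ _ (sub [:: false; true; true; false; true; true]).
have h4 := K4 _ _ _ _ (sub [:: false; true; true; true; false; true]).
have h5 := K4 _ _ _ _ (sub [:: false; true; true; true; true; false]).
have h6 := K4 _ _ _ _ (sub [:: true; false; false; true; true; true]).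
have h7 := K4 _ _ _ _ (sub [:: true; false; true; false; true; true]).
have h8 := K4 _ _ _ _ (sub [:: true; false; true; true; false; true]).
have h9 := K4 _ _ _ _ (sub [:: true; false; true; true; true; false]).
have h10 := K4 _ _ _ _ (sub [:: true; true; false; false; true; true]).
have h11 := K4 _ _ _ _ (sub [:: true; true; false; true; false; true]).
have h12 := K4 _ _ _ _ (sub [:: true; true; false; true; true; false]).
have h13 := K4 _ _ _ _ (sub [:: true; true; true; false; false; true]).
have h14 := K4 _ _ _ _ (sub [:: true; true; true; false; true; false]).
have h15 := K4 _ _ _ _ (sub [:: true; true; true; true; false; false]).
rewrite F_sym; clear -h1 h2 h3 h4 h5 h6 h7 h8 h9 h10 h11 h12 h13 h14 h15.
lra.
Qed.

(** Write the sign vector that is -1 on s as 1 - 2 * 1_s and expand the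
    quadratic form. The empty s gives the total sum, a one-letter s then gives
    the sum around a vertex, and with both known a four-letter s gives the sum
    over a complete graph on four vertices. *)
Lemma flipped_sums_zero :
  (forall s, uniq s -> (size s \in [:: 0; 1; 4])%N ->
     \sum_a \sum_b (1 - (2 * (a \in s))%N%:R) * (1 - (2 * (b \in s))%N%:R) * F a
       b = 0) ->
  forall a b, F a b = 0.
Proof.
move=> hs.
pose V a := \sum_b F a b.
have total : \sum_a V a = 0.
  have := hs [::] isT isT; congr (_ = _); apply: eq_bigr => a _.
  by apply: eq_bigr => b _; rewrite !in_nil muln0 subr0 !mul1r.
have expand s : uniq s ->
  \sum_a \sum_b (1 - (2 * (a \in s))%N%:R) * (1 - (2 * (b \in s))%N%:R) * F a b
  = \sum_a V a - 4 * (\sum_(a <- s) V a)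
    + 4 * \sum_(a <- s) \sum_(b <- s) F a b.
  move=> us.
  have in_s (G : 'I_9 -> R) : \sum_(a <- s) G a = \sum_a (a \in s)%:R * G a.
    rewrite big_uniq // big_mkcond /=; apply: eq_bigr => a _.
    by case: (a \in s); rewrite ?mul1r ?mul0r.
  have -> : \sum_(a <- s) V a = \sum_a \sum_b (a \in s)%:R * F a b.
    by rewrite in_s; apply: eq_bigr => a _; rewrite big_distrr.
  have -> : \sum_(a <- s) \sum_(b <- s) F a b =
      \sum_a \sum_b (a \in s)%:R * (b \in s)%:R * F a b.
    rewrite in_s; apply: eq_bigr => a _; rewrite in_s big_distrr.
    by apply: eq_bigr => b _; rewrite /= mulrA.
  have -> : \sum_a \sum_b (1 - (2 * (a \in s))%N%:R) *
    (1 - (2 * (b \in s))%N%:R) * F a b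
    = \sum_a \sum_b F a b - 2 * (\sum_a \sum_b (a \in s)%:R * F a b)
      - 2 * (\sum_a \sum_b (b \in s)%:R * F a b)
      + 4 * \sum_a \sum_b (a \in s)%:R * (b \in s)%:R * F a b.
    rewrite !big_distrr /= -!sumrB -big_split; apply: eq_bigr => a _.
    rewrite /= !big_distrr /= -!sumrB -big_split; apply: eq_bigr => b _.
    by rewrite /= !natrM; ring.
  have -> : \sum_a \sum_b (b \in s)%:R * F a b = \sum_a \sum_b (a \in s)%:R * F
    a b.
    by rewrite exchange_big; apply: eq_bigr => a _; apply: eq_bigr => b _;
      rewrite F_sym.
  rewrite /V; ring.
have vertex a : V a = 0.
  have := hs [:: a] isT isT; rewrite expand // total !big_seq1 F_diag.
  by clear; lra.
apply: K4_sums_zero => a b c d us.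
have := hs [:: a; b; c; d] us isT; rewrite expand // total.
rewrite !big_cons !big_nil !vertex !F_diag (F_sym b a) (F_sym c a) (F_sym c b)
  (F_sym d a) (F_sym d b) (F_sym d c).
by clear; lra.
Qed.
End EdgeWeights.

Section Injectivity.
Context (R : realType) (I : 'I_9 -> 'M[R]_16) (hI : spin9_generators I).
Local Notation E := 'cV[R]_16.
Implicit Types (gam : @homtype R) (J : 'M[R]_16).

(** The contraction of an alternating expression with a symmetric matrix
    vanishes. *)
Lemma contract_symmetric gam J :
  (forall x y, gam x *m y = - (gam y *m x)) -> J^T = J ->
  \sum_i gam (basis i) *m (J *m basis i) = 0.
Proof.
move=> hg hJ.
have Je i : J *m basis i = \sum_j J j i *: basis j.
  by rewrite [LHS]matrix_sum_delta; apply: eq_bigr => j _;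
    rewrite big_ord1 -colE mxE.
have eX : \sum_i gam (basis i) *m (J *m basis i) =
    \sum_i \sum_j J j i *: (gam (basis i) *m basis j).
  by apply: eq_bigr => i _; rewrite Je mulmx_sumr; apply: eq_bigr => j _;
    rewrite -scalemxAr.
suff : \sum_i gam (basis i) *m (J *m basis i) = - \sum_i gam (basis i)
  *m (J *m basis i).
  by move/eqP; rewrite -addr_eq0 -mulr2n -scaler_nat scaler_eq0 pnatr_eq0
    => /eqP.
rewrite eX {1}exchange_big -sumrN; apply: eq_bigr => i _.
rewrite -sumrN; apply: eq_bigr => j _.
by rewrite hg scalerN -{1}hJ mxE.
Qed.

(** Reversing n distinct letters takes 'C(n, 2) transpositions of anticommuting
    neighbours. So words of 0, 1 or 4 distinct letters are symmetric. *)
Lemma word_rev s : uniq s -> word I (rev s) = (-1) ^+ 'C(size s, 2) *: word I s.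
Proof.
elim: s => [|a s IH] /=; first by rewrite expr0 scale1r.
case/andP=> nas us; rewrite rev_cons -cats1 word_cat IH //= mulmx1
  (gen_word hI).
have -> : count (predC1 a) s = size s.
  have := count_predC (pred1 a) s.
  by rewrite count_uniq_mem // (negPf nas) add0n.
rewrite scalerA -scalemxAl -exprD binS bin1; congr (_ *: _).
by rewrite -addnA addnn exprD -mul2n exprM sqrrN !expr1n mulr1.
Qed.

(** The sign by which I_a and the word s commute. *)
Definition sgn9 (s : seq 'I_9) (a : 'I_9) : R := (-1) ^+ count (predC1 a) s.

Lemma sgn9E s a : uniq s ->
  sgn9 s a = (-1) ^+ size s * (1 - (2 * (a \in s))%N%:R).
Proof.
move=> us; rewrite /sgn9; have := count_predC (pred1 a) s.
rewrite count_uniq_mem // => <-; case: (a \in s) => /=.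
  by rewrite exprS; ring.
by rewrite subr0 mulr1.
Qed.

Lemma gen2_word p s :
  gen2 I p *m word I s = (sgn9 s p.1 * sgn9 s p.2) *: (word I s *m gen2 I p).
Proof.
rewrite /gen2 -(mulmxA (I p.1)) (gen_word hI p.2) -scalemxAr (mulmxA (I p.1)).
by rewrite (gen_word hI p.1) -scalemxAl scalerA mulrC mulmxA.
Qed.

(** The values of gam lie in spin(9), so gam(x) is a combination of the I_a I_b
    with coefficients u_ab(x) = <U_ab, x>. Contracting with a symmetric word J
    and moving J to the left gives the vanishing of the sum of the vectors I_a
    I_b U_ab, weighted by the signs with which I_a and I_b commute with J. *)
Lemma Theta_inj0 gam : alternating3 gam -> Theta I gam = 0 -> gam = 0.
Proof.
case=> hskew halt hT.
have hs x : gam x \in spin9 I.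
  by apply: pr_m_eq0; rewrite // -ThetaE hT zero_lfunE.
pose u p (x : E) := 16^-1 * trdot (gen2 I p) (gam x).
have gE x : gam x = \sum_(p | pair9 p) u p x *: gen2 I p.
  have N0 : (16 : R) != 0 by rewrite pnatr_eq0.
  by apply: (orth_span_coord N0 (@gen2_orth _ _ hI)); rewrite -spin9E.
pose U p : E := \sum_i u p (basis i) *: basis i.
pose f p : E := gen2 I p *m U p.
(* Moving the word across each I_a I_b produces the two signs; the word itself
   is invertible and drops out. *)
have weighted s : uniq s -> (size s \in [:: 0; 1; 4])%N ->
  \sum_(p | pair9 p) (sgn9 s p.1 * sgn9 s p.2) *: f p = 0.
  move=> us hsz; have hJ : (word I s)^T = word I s.
    rewrite trmx_word // word_rev // !inE in hsz *.
    by case/or3P: hsz => /eqP ->; rewrite /= -signr_odd expr0 scale1r.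
  have := contract_symmetric halt hJ.
  have -> : \sum_i gam (basis i) *m (word I s *m basis i) =
    word I s *m \sum_(p | pair9 p) (sgn9 s p.1 * sgn9 s p.2) *: f p.
    rewrite mulmx_sumr.
    have -> : \sum_i gam (basis i) *m (word I s *m basis i) =
       \sum_i \sum_(p | pair9 p) u p (basis i)
         *: (gen2 I p *m word I s *m basis i).
      apply: eq_bigr => i _; rewrite gE mulmx_suml; apply: eq_bigr => p _.
      by rewrite -scalemxAl mulmxA.
    rewrite exchange_big; apply: eq_bigr => p _.
    rewrite -scalemxAr /f mulmxA /U mulmx_sumr scaler_sumr;
      apply: eq_bigr => i _.
    by rewrite gen2_word -scalemxAl -scalemxAr !scalerA mulrC.
  move/(congr1 (mulmx (word I s)^T)).
  by rewrite mulmxA word_orthogonal // mul1mx mulmx0.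
have f0 p : pair9 p -> f p = 0.
  move=> hp; apply/matrixP => r z; rewrite ord1 [RHS]mxE {z}.
  (* Symmetric weights on the edges, given by the r-th coordinates. *)
  pose F (a b : 'I_9) := (if (a < b)%N then f (a, b) r 0 else 0) +
                (if (b < a)%N then f (b, a) r 0 else 0).
  have Fs a b : F a b = F b a by rewrite /F addrC.
  have Fd a : F a a = 0 by rewrite /F ltnn addr0.
  suff F0 : forall a b, F a b = 0.
    have := F0 p.1 p.2; rewrite /F; move: hp; rewrite /pair9 => hp.
    by rewrite hp ltnNge (ltnW hp) addr0 -surjective_pairing.
  apply: (flipped_sums_zero Fs Fd) => s us hsz.
  have := congr1 (fun v : E => v r 0) (weighted s us hsz).
  rewrite summxE [RHS]mxE sum_pair9 => h.
  have {}h : \sum_a \sum_b (sgn9 s a * sgn9 s b) *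
    (if (a < b)%N then f (a, b) r 0 else 0) = 0.
    rewrite -[RHS]h; apply: eq_bigr => a _; rewrite [RHS]big_mkcond.
    by apply: eq_bigr => b _; case: ifP; rewrite ?mulr0 ?mxE.
  have h' : \sum_a \sum_b (sgn9 s a * sgn9 s b) *
    (if (b < a)%N then f (b, a) r 0 else 0) = 0.
    by rewrite exchange_big -[RHS]h; apply: eq_bigr => a _;
      apply: eq_bigr => b _;
      rewrite [sgn9 s b * _]mulrC.
  transitivity (\sum_a \sum_b (sgn9 s a * sgn9 s b) * F a b).
    apply: eq_bigr => a _; apply: eq_bigr => b _; rewrite !sgn9E //.
    by rewrite mulrACA -expr2 sqrr_sign mul1r.
  under eq_bigr => a _ do under eq_bigr => b _ do rewrite /F mulrDr.
  under eq_bigr => a _ do rewrite big_split.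
  by rewrite big_split /= h h' addr0.
have U0 p : pair9 p -> U p = 0.
  move=> hp; have := f0 p hp; rewrite /f gen2E
    => /(congr1 (mulmx (word I [:: p.1; p.2])^T)).
  by rewrite mulmxA word_orthogonal // mul1mx mulmx0.
have g0 i : gam (basis i) = 0.
  rewrite gE big1 // => p hp; have := congr1 (fun v : E => v i 0) (U0 p hp).
  rewrite summxE mxE (bigD1 i) //= big1 => [|j ji].
    by rewrite /basis !mxE !eqxx mulr1 addr0 => ->; rewrite scale0r.
  by rewrite /basis !mxE eq_sym (negPf ji) mulr0.
apply/lfunP => x; rewrite zero_lfunE [x]matrix_sum_delta linear_sum big1 //
  => i _.
by rewrite big_ord1 linearZ /= [gam _]g0 scaler0.
Qed.
End Injectivity.

(** * The 560-dimensional space of 3-forms *)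

Section ThreeForms.
Context (R : realType).
Local Notation E := 'cV[R]_16.
Local Notation coefs := ('I_16 -> 'I_16 -> 'I_16 -> R).
Implicit Types (gam : @homtype R) (c : coefs).

(** The coefficient of indices q, r, s of gam is gam(e_q)_(r, s); the first
    index is the one of the argument. *)
Definition hom_coef gam : coefs := fun q r s => gam (basis q) r s.

Definition hom_of_coef c : homtype :=
  linfun (fun x : E => \matrix_(r < 16, s < 16) \sum_q x q 0 * c q r s).

Lemma hom_of_coefE c x r s : hom_of_coef c x r s = \sum_q x q 0 * c q r s.
Proof.
rewrite /hom_of_coef linfunE ?mxE // => k y z; apply/matrixP => i j.
rewrite !mxE big_distrr -big_split; apply: eq_bigr => q _.
by rewrite !mxE /= mulrDl mulrA.
Qed.

Lemma hom_coefE gam x r s : gam x r s = \sum_q x q 0 * hom_coef gam q r s.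
Proof.
rewrite {1}[x]matrix_sum_delta linear_sum summxE; apply: eq_bigr => q _.
by rewrite big_ord1 linearZ mxE.
Qed.

Lemma hom_of_coefK c q r s : hom_coef (hom_of_coef c) q r s = c q r s.
Proof.
rewrite /hom_coef hom_of_coefE (bigD1 q) //= big1 => [|j jq].
  by rewrite /basis mxE !eqxx mul1r addr0.
by rewrite /basis mxE (negPf jq) mul0r.
Qed.

Lemma hom_coef_inj gam gam' :
  (forall q r s, hom_coef gam q r s = hom_coef gam' q r s) -> gam = gam'.
Proof.
move=> h; apply/lfunP => x; apply/matrixP => r s.
by rewrite !hom_coefE; apply: eq_bigr => q _; rewrite h.
Qed.

(** The conditions on gam are the antisymmetry of its coefficients under two
    transpositions, which generate all the permutations of the three indices. *)
Lemma alternating3P gam : alternating3 gam <->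
  (forall q r s, hom_coef gam q s r = - hom_coef gam q r s) /\
  (forall q r s, hom_coef gam s r q = - hom_coef gam q r s).
Proof.
split=> [[h1 h2]|[h1 h2]]; split.
- move=> q r s; have /matrixP/(_ r s) := h1 (basis q).
  by rewrite !mxE.
- move=> q r s; have := h2 (basis s) (basis q).
  by rewrite -!colE => /matrixP/(_ r 0); rewrite !mxE.
- move=> x; apply/matrixP => r s; rewrite !mxE !hom_coefE -sumrN.
  by apply: eq_bigr => q _; rewrite h1 mulrN.
- move=> x y; apply/matrixP => r z; rewrite !mxE -sumrN ord1 {z}.
  under eq_bigr => q _ do rewrite hom_coefE big_distrl.
  under [RHS]eq_bigr => q _ do rewrite hom_coefE big_distrl -sumrN.
  rewrite exchange_big; apply: eq_bigr => q _; apply: eq_bigr => s _ /=.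
  by rewrite h2; ring.
Qed.

Definition increasing3 : pred ('I_16 * 'I_16 * 'I_16) :=
  fun t => (t.1.1 < t.1.2)%N && (t.1.2 < t.2)%N.

Local Notation T3 := {t : 'I_16 * 'I_16 * 'I_16 | increasing3 t}.

Lemma card_T3 : #|{: T3}| = 560%N.
Proof.
rewrite card_sig -[LHS]/#|[pred t | increasing3 t]| card_increasing_triples.
by rewrite unlock.
Qed.

Definition increasing_coef (v : 'rV[R]_#|{: T3}|) : coefs := fun q r s =>
  if insub (q, r, s) is Some t then v 0 (enum_rank (t : T3)) else 0.

Definition alternation c : coefs := fun q r s =>
  c q r s - c q s r + c r s q - c r q s + c s q r - c s r q.

(** A vector indexed by increasing triples, extended by zero to all the triples
    and then antisymmetrized. At an increasing triple only the first of the six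
    terms survives, so no factor 1/6 is needed. *)
Definition wedge v := hom_of_coef (alternation (increasing_coef v)).

Lemma wedge_coef v q r s :
  hom_coef (wedge v) q r s = alternation (increasing_coef v) q r s.
Proof. exact: hom_of_coefK. Qed.

Lemma wedge_linear : linear wedge.
Proof.
move=> k x y; apply: hom_coef_inj => q r s.
rewrite {2}/hom_coef add_lfunE scale_lfunE 2!mxE -!/(hom_coef _ _ _ _)
  !wedge_coef.
have e (a b d : 'I_16) : increasing_coef (k *: x + y) a b d
    = k * increasing_coef x a b d + increasing_coef y a b d.
  by rewrite /increasing_coef; case: insubP => [t _ _|_];
    rewrite ?mxE // mulr0 addr0.
by rewrite /alternation !e; ring.
Qed.

Lemma wedge_alternating v : alternating3 (wedge v).
Proof.
by apply/alternating3P; split=> q r s; rewrite !wedge_coef /alternation; ring.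
Qed.

Lemma increasing_coefE v q r s (h : increasing3 (q, r, s)) :
  increasing_coef v q r s = v 0 (enum_rank (exist _ (q, r, s) h : T3)).
Proof.
by rewrite /increasing_coef insubT.
Qed.

Lemma increasing_coef0 v q r s : ~~ increasing3 (q, r, s) ->
  increasing_coef v q r s = 0.
Proof. by move=> h; rewrite /increasing_coef insubN. Qed.

Lemma wedge_inj0 v : wedge v = 0 -> v = 0.
Proof.
move=> h; apply/matrixP => z n; rewrite ord1 mxE {z} -(enum_valK n).
case: (enum_val n) => [[[q r] s] hqrs]; have /andP[/= qr rs] := hqrs.
rewrite -increasing_coefE.
have := wedge_coef v q r s; rewrite h /hom_coef zero_lfunE mxE /alternation.
rewrite (@increasing_coef0 v q s r) 1?(@increasing_coef0 v r s q)
  1?(@increasing_coef0 v r q s)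
  1?(@increasing_coef0 v s q r) 1?(@increasing_coef0 v s r q);
  rewrite /increasing3 /= -?leqNgt; try lia.
by rewrite !subr0 !addr0 => ->.
Qed.

(** Antisymmetric coefficients vanish on triples with a repetition, and are
    determined by their values on increasing triples. *)
Lemma alternating3_wedge gam : alternating3 gam -> exists v, gam = wedge v.
Proof.
move/alternating3P=> [h1 h2].
exists (\row_n let: t := val (enum_val n) in hom_coef gam t.1.1 t.1.2 t.2).
set v := \row_n _; apply: hom_coef_inj => q r s; rewrite wedge_coef.
have e (a b d : 'I_16) : increasing_coef v a b d =
    if (a < b)%N && (b < d)%N then hom_coef gam a b d else 0.
  case: ifP => [h|/negbT h]; last by rewrite increasing_coef0.
  by rewrite increasing_coefE mxE enum_rankK.
rewrite /alternation !e.
have r3 (a b d : 'I_16) : hom_coef gam b a d = - hom_coef gam a b d.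
  by rewrite h1 h2 h1 opprK.
have z1 a b : hom_coef gam a b b = 0 by have := h1 a b b; lra.
have z2 a b : hom_coef gam a b a = 0 by have := h2 a b a; lra.
have z3 a b : hom_coef gam a a b = 0 by have := r3 a a b; lra.
have [qr|qr|/val_inj qr] := ltngtP q r; have [rs|rs|/val_inj rs] := ltngtP r s;
  have [qs|qs|/val_inj qs] := ltngtP q s; subst; try lia;
  rewrite /= ?ltnn ?z1 ?z2 ?z3; try lra.
all: have := h1 q r s; have := h2 q r s; have := r3 q r s;
     have := h1 r q s; have := h1 s q r; have := h1 s r q; lra.
Qed.
End ThreeForms.

(** * The image of the 3-forms is the sum of P1 and P2 *)

Section Image.
Context (R : realType) (I : 'I_9 -> 'M[R]_16) (hI : spin9_generators I).
Local Notation T3 := {t : 'I_16 * 'I_16 * 'I_16 | increasing3 t}.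
Implicit Types (gam : @homtype R).

Definition wedge_hom : 'Hom('rV[R]_#|{: T3}|, @homtype R) := linfun (@wedge R).

Lemma wedge_homE v : wedge_hom v = wedge v.
Proof. exact/linfunE/wedge_linear. Qed.

Lemma Theta_linear : linear (@Theta R I).
Proof.
move=> k x y; apply/lfunP => z.
by rewrite add_lfunE scale_lfunE !ThetaE add_lfunE scale_lfunE linearP.
Qed.

Definition Theta_wedge : 'Hom('rV[R]_#|{: T3}|, @homtype R) :=
  (linfun (@Theta R I) \o wedge_hom)%VF.

Lemma Theta_wedgeE v : Theta_wedge v = Theta I (wedge v).
Proof.
by rewrite /Theta_wedge comp_lfunE wedge_homE (linfunE Theta_linear).
Qed.

Definition Theta_img : {vspace @homtype R} := limg Theta_wedge.

Lemma mem_Theta_img gam' :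
  gam' \in Theta_img <-> exists2 gam, alternating3 gam & gam' = Theta I gam.
Proof.
split=> [/memv_imgP[v _ ->]|[gam hgam ->]].
  by exists (wedge v); rewrite ?Theta_wedgeE //; exact: wedge_alternating.
have [v ->] := alternating3_wedge hgam.
by apply/memv_imgP; exists v; rewrite ?memvf // Theta_wedgeE.
Qed.

Lemma dim_Theta_img : \dim Theta_img = 560%N.
Proof.
rewrite /Theta_img limg_dim_eq ?dimvf.
  by rewrite dim_matrix mul1r card_T3.
apply/eqP; rewrite -subv0; apply/subvP => v /memv_capP[_].
rewrite memv_ker Theta_wedgeE memv0
  => /eqP/(Theta_inj0 hI (wedge_alternating v)).
by move/wedge_inj0 => ->.
Qed.

(** As Theta is injective on 3-forms, this is its inverse on the image. Being
    linear on the whole space, it preserves smoothness. *)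
Definition Theta_inv : 'End(@homtype R) := (wedge_hom \o Theta_wedge^-1)%VF.

Lemma Theta_inv_alternating gam' : alternating3 (Theta_inv gam').
Proof. rewrite /Theta_inv comp_lfunE wedge_homE; exact: wedge_alternating. Qed.

Lemma Theta_invK gam' : gam' \in Theta_img -> Theta I (Theta_inv gam') = gam'.
Proof.
move=> h; rewrite /Theta_inv comp_lfunE wedge_homE -Theta_wedgeE.
exact: limg_lfunVK.
Qed.

Lemma alternating3B gam gam' : alternating3 gam -> alternating3 gam' ->
  alternating3 (gam - gam').
Proof.
move=> [h1 h2] [h3 h4]; split=> [x|x y]; rewrite !add_lfunE !opp_lfunE.
  by rewrite linearB /= h1 h3 opprB opprK addrC.
by rewrite !mulmxBl h2 h4 opprB opprK addrC.
Qed.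

Lemma Theta_inj gam gam' : alternating3 gam -> alternating3 gam' ->
  Theta I gam = Theta I gam' -> gam = gam'.
Proof.
move=> h h' e; apply/eqP; rewrite -subr_eq0; apply/eqP.
apply: (Theta_inj0 hI (alternating3B h h')).
by apply/lfunP => x; rewrite ThetaE add_lfunE opp_lfunE linearB /= -!ThetaE e
  subrr zero_lfunE.
Qed.

Lemma Theta_img_submodule : submodule I Theta_img.
Proof.
move=> h hh gam' /mem_Theta_img[gam hgam ->]; apply/mem_Theta_img.
exists (spin9_act h gam); first exact: (alternating3_act hh).
by rewrite (Theta_act hI hh hgam).
Qed.
End Image.

Section Splitting.
Context (R : realType) (I : 'I_9 -> 'M[R]_16).
Implicit Types (U F Q : {vspace @homtype R}).

Lemma spin9_actD h x y :
  spin9_act h (x + y) = spin9_act h x + spin9_act h y :> @homtype R.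
Proof. by rewrite -[x]scale1r spin9_act_linear !scale1r. Qed.

Lemma submodule_add U F : submodule I U -> submodule I F -> submodule I (U + F).
Proof.
move=> hU hF h hh gam /memv_addP[u uU [f fF ->]].
by rewrite spin9_actD memv_add ?hU ?hF.
Qed.

Lemma submodule_cap U F : submodule I U -> submodule I F ->
  submodule I (U :&: F).
Proof.
by move=> hU hF h hh gam /memv_capP[gU gF]; rewrite memv_cap hU ?hF.
Qed.

(** The projections attached to a direct sum of submodules are equivariant. *)
Lemma submodule_pi Q F U : submodule I Q -> submodule I F -> submodule I U ->
  (Q :&: F = 0)%VS -> (U <= Q + F)%VS -> submodule I (daddv_pi Q F @: U).
Proof.
move=> hQ hF hU dQF sU h hh _ /memv_imgP[u uU ->].
apply/memv_imgP; exists (spin9_act h u); first exact: hU.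
have /memv_addP[q qQ [f fF ->]] := subvP sU _ uU.
have piE q' f' : q' \in Q -> f' \in F -> daddv_pi Q F (q' + f') = q'.
  move=> hq hf; rewrite linearD /= daddv_pi_id //.
  have /eqP -> : daddv_pi Q F f' == 0.
    by rewrite daddv_pi_eq0 // (subvP (addvSr _ _)).
  by rewrite addr0.
by rewrite spin9_actD !piE ?hQ ?hF.
Qed.

(** The projection of U to Q along F is a submodule of the irreducible Q, and
    its kernel on U is the intersection of U and F. *)
Lemma submodule_dichotomy Q F U : irreducible_submodule I Q -> submodule I F ->
  submodule I U -> (Q :&: F = 0)%VS -> (U <= Q + F)%VS ->
  (U <= F)%VS \/ \dim U = (\dim (U :&: F) + \dim Q)%N.
Proof.
move=> [hQ Q0 irr] hF hU dQF sU.
have ker : (U :&: lker (daddv_pi Q F) = U :&: F)%VS.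
  apply/vspaceP => u; rewrite !memv_cap memv_ker;
    case: (boolP (u \in U)) => //= uU.
  by rewrite daddv_pi_eq0 // (subvP sU).
have dimU := limg_ker_dim (daddv_pi Q F) U; rewrite ker in dimU.
have [|im0|imQ] := irr (daddv_pi Q F @: U)%VS (submodule_pi hQ hF hU dQF sU).
- by apply/subvP => _ /memv_imgP[u _ ->]; exact: memv_pi.
- left; apply/subvP => u uU; have : u \in (U :&: lker (daddv_pi Q F))%VS.
    rewrite memv_cap uU memv_ker -memv0 -im0; exact: memv_img.
  by rewrite ker => /memv_capP[].
- by right; rewrite -dimU imQ.
Qed.

Variable S : splitting I.

(** The whole sum has dimension 1344 = 16 + 128 + 432 + 768, which leaves no
    room for a nonzero intersection. *)
Lemma splitting_dims :
  [/\ (P3 S :&: (P0 S + P1 S + P2 S) = 0)%VS,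
      (P0 S :&: (P1 S + P2 S) = 0)%VS,
      (P1 S :&: P2 S = 0)%VS,
      \dim (P1 S + P2 S) = 560%N
    & ((P0 S + P3 S) :&: (P1 S + P2 S) = 0)%VS].
Proof.
have tot : \dim (P0 S + P1 S + P2 S + P3 S) = 1344%N.
  by have /directvP /= -> := splitting_direct S;
    rewrite P0_dim P1_dim P2_dim P3_dim.
have c3 := dimv_sum_cap (P0 S + P1 S + P2 S) (P3 S).
have c0 := dimv_sum_cap (P0 S) (P1 S + P2 S).
have c1 := dimv_sum_cap (P1 S) (P2 S).
have c03 := dimv_sum_cap (P0 S + P3 S) (P1 S + P2 S).
have c033 := dimv_sum_cap (P0 S) (P3 S).
rewrite addvA in c0.
have e03 : (P0 S + P3 S + (P1 S + P2 S) = P0 S + P1 S + P2 S + P3 S)%VS.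
  by rewrite -!addvA [(P3 S + _)%VS]addvC -!addvA.
rewrite e03 in c03.
move: c3 c0 c1 c03 c033; rewrite tot P0_dim P1_dim P2_dim P3_dim
  => c3 c0 c1 c03 c033.
have d12 : \dim (P1 S + P2 S) = 560%N by lia.
split => //; apply/eqP; rewrite -dimv_eq0 ?[(P3 S :&: _)%VS]capvC; lia.
Qed.

(** Peel off P3, then P0, then P1 with the previous dichotomy, and compare
    dimensions at each step. *)
Lemma submodule_dim560 U : submodule I U -> \dim U = 560%N ->
  (U <= P0 S + P1 S + P2 S + P3 S)%VS -> U = (P1 S + P2 S)%VS.
Proof.
move=> hU dU sU; have [d3 d0 d1 d12 _] := splitting_dims.
have [h0 _ _] := P0_irr S; have [h1 _ irr1] := P1_irr S.
have [h2 _ irr2] := P2_irr S; have [h3 _ _] := P3_irr S.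
have h12 := submodule_add h1 h2.
have h012 : submodule I (P0 S + P1 S + P2 S) by rewrite -addvA;
  apply: submodule_add.
(* The dimension 768 of P3 exceeds 560. *)
have {}sU : (U <= P0 S + (P1 S + P2 S))%VS.
  rewrite addvA; rewrite addvC in sU.
  have [//|] := submodule_dichotomy (P3_irr S) h012 hU d3 sU.
  by rewrite dU P3_dim; lia.
(* If P0 occurred in U, the rest would have dimension 544, which is none of 0,
   128, 432 and 560. *)
have {}sU : (U <= P1 S + P2 S)%VS.
  have [//|] := submodule_dichotomy (P0_irr S) h12 hU d0 sU.
  rewrite dU P0_dim; set W := (U :&: _)%VS => dW.
  have hW : submodule I W by apply: submodule_cap.
  have sW : (W <= P1 S + P2 S)%VS by apply: capvSr.
  have [sW2|] := submodule_dichotomy (P1_irr S) h2 hW d1 sW.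
    by have := dimvS sW2; rewrite P2_dim; lia.
  have [] := irr2 (W :&: P2 S)%VS (submodule_cap hW h2) (capvSr _ _) => ->.
    by rewrite dimv0 P1_dim; lia.
  by rewrite P1_dim P2_dim; lia.
by apply/eqP; rewrite -(geq_leqif (dimv_leqif_eq sU)) dU d12.
Qed.

Hypothesis hI : spin9_generators I.

Lemma Theta_imgE : Theta_img I = (P1 S + P2 S)%VS.
Proof.
apply: submodule_dim560; [exact: Theta_img_submodule | exact: dim_Theta_img |].
apply/subvP => gam' /mem_Theta_img[gam _ ->]; apply/splitting_total => x.
by rewrite ThetaE; exact: mem_pr_m.
Qed.

Lemma part03_eq0 (gam : @homtype R) : (forall x, gam x \in mpart I) ->
  (part03 S gam = 0 <-> gam \in Theta_img I).
Proof.
move=> /(splitting_total S) hgam; have [_ _ _ _ d] := splitting_dims.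
rewrite Theta_imgE /part03; suff <- :
  (daddv_pi (P0 S + P3 S) (P1 S + P2 S) gam == 0)
   = (gam \in (P1 S + P2 S)%VS) by split=> [->|/eqP].
rewrite daddv_pi_eq0 //; move: hgam.
by rewrite -!addvA [(P3 S + _)%VS]addvC -!addvA.
Qed.
End Splitting.

Section FormOfHom.
Context (R : realType) (I : 'I_9 -> 'M[R]_16) (hI : spin9_generators I).
Local Notation E := 'cV[R]_16.
Implicit Types (gam : @homtype R).

(** Summing over i < j yields half of the trace form, and 1/8 times 1/2 is the
    factor 1/16 of the orthogonal projection. *)
Lemma embed3_pr_m gam (mu : E -> E -> E -> R) x : (gam x)^T = - gam x ->
  (forall i j, mu (basis i) (basis j) x = dotmx (gam x *m basis i) (basis j)) ->
  embed3 I mu x = pr_m I (gam x).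
Proof.
move=> hskew hmu; rewrite pr_mE // /embed3 sum_triple9 scaler_sumr.
apply: eq_bigr => a _; rewrite scaler_sumr; apply: eq_bigr => b ab.
rewrite scaler_sumr; apply: eq_bigr => c bc.
rewrite scalerA; congr (_ *: _).
have dotE (A : 'M[R]_16) i j : dotmx (A *m basis i) (basis j) = A j i.
  by rewrite /dotmx /basis -!colE !mxE.
have g3s i j : gen3 I (a, b, c) j i = - gen3 I (a, b, c) i j.
  have /(gen3_skew hI)/matrixP/(_ i j) :
    triple9 (a, b, c) by rewrite /triple9 /= ab bc.
  by rewrite !mxE.
have gs i j : gam x j i = - gam x i j by have /matrixP/(_ i j) := hskew;
  rewrite !mxE.
have -> : Defs.contract (Defs.sigma I a b c) mu x =
    \sum_(i < 16) \sum_(j < 16 | (i < j)%N) gen3 I (a, b, c) i j * gam x i j.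
  apply: eq_bigr => i _; apply: eq_bigr => j _.
  by rewrite hmu /Defs.sigma !dotE g3s gs mulrNN.
set G := gen3 I (a, b, c); pose H i j := G i j * gam x i j.
have Hs i j : H j i = H i j by rewrite /H g3s gs mulrNN.
have Hd i : H i i = 0.
  by rewrite /H; have -> : gam x i i = 0 by [have := gs i i; lra];
    rewrite mulr0.
suff -> : trdot G (gam x) = 2 * \sum_(i < 16) \sum_(j < 16 | (i < j)%N) H i j.
  by rewrite mulrA; congr (_ * _); field.
rewrite trdotE -/(H _ _).
transitivity (\sum_(i < 16) \sum_(j < 16) ((if (i < j)%N then H i j else 0)
   + (if (j < i)%N then H j i else 0))).
  apply: eq_bigr => i _; apply: eq_bigr => j _; rewrite -/(H i j).
  by case: (ltngtP i j) => [_|_|/val_inj <-]; rewrite ?addr0 ?add0r // Hd addr0.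
under eq_bigr => i _ do rewrite big_split.
rewrite big_split /= [X in _ + X]exchange_big /= -mulr2n -[LHS]mulr_natl;
  congr (_ * _).
by apply: eq_bigr => i _; rewrite [RHS]big_mkcond.
Qed.
End FormOfHom.

(** * Smooth functions on open sets of the model space *)

(** The two functions have the same Taylor expansion of order one at x. *)
Lemma near_eq_differentiable (R : numFieldType) (V W : normedModType R)
    (f g : V -> W) (x : V) :
  (\near x, f x = g x) -> differentiable f x -> differentiable g x.
Proof.
move=> fg df; have fgx : f x = g x by apply: nbhs_singleton fg.
have cdf : continuous ('d f x) by apply: diff_continuous.
have nf0 : \forall y \near (0 : V), f (y + x) = g (y + x).
  by move: fg; rewrite (near_shift 0) subr0.
have gE : g \o shift x = cst (g x) + 'd f x +o_ 0 id.
  apply/eqaddoP => e e0; have /eqaddoP/(_ e e0) := diff_locally df => h.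
  near=> y.
  have -> : (g \o shift x - (cst (g x) + 'd f x)) y
      = (f \o shift x - (cst (f x) + 'd f x)) y.
    rewrite -[LHS]/(g (y + x) - (g x + 'd f x y)).
    rewrite -[RHS]/(f (y + x) - (f x + 'd f x y)).
    by rewrite fgx; congr (_ - _); apply/esym; near: y.
  near: y; exact: h.
have e := diff_unique cdf gE.
by apply/diff_locallyP; rewrite e.
Unshelve. all: by end_near. Qed.

Section Ck.
Context {R : realType}.
Local Notation E := 'cV[R]_16.
Implicit Types (U : set E).

Lemma Ck_onS (V : normedModType R) k U (f : E -> V) :
  Ck_on k.+1 U f -> Ck_on k U f.
Proof.
elim: k f => [|k IH] f [df Df] /=.
  by move=> x /df; exact: differentiable_continuous.
by split=> // v; apply/IH/Df.
Qed.

(** On an open set, equality of functions passes to their derivatives; this is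
    where openness matters. *)
Lemma Ck_on_ext (V : normedModType R) k U (f g : E -> V) : open U ->
  (forall x, U x -> f x = g x) -> Ck_on k U f -> Ck_on k U g.
Proof.
move=> oU; elim: k f g => [|k IH] f g fg /=.
  move=> cf x Ux; have nf : \forall y \near x, f y = g y.
    by near=> y; apply: fg; near: y; exact: open_nbhs_nbhs.
  rewrite /prop_for /continuous_at -(fg x Ux).
  exact: cvg_trans (near_eq_cvg nf) (cf x Ux).
move=> [df Df]; split.
  move=> x Ux; apply: near_eq_differentiable (df _ Ux).
  by near=> y; apply: fg; near: y; exact: open_nbhs_nbhs.
move=> v; apply: IH (Df v) => x Ux; apply: near_eq_derive.
by near=> y; apply: fg; near: y; exact: open_nbhs_nbhs.
Unshelve. all: by end_near. Qed.

(** All the conditions in the definition of C^k are pointwise. *)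
Lemma Ck_on_local (V : normedModType R) k U (f : E -> V) :
  (forall x, U x -> exists W, W x /\ Ck_on k W f) -> Ck_on k U f.
Proof.
elim: k f => [|k IH] f h /=.
  by move=> x /h[W [Wx]]; apply.
split=> [x /h[W [Wx []]]|v]; first by move=> h' _; exact: h'.
by apply: IH => x /h[W [Wx [_ /(_ v)]]]; exists W.
Qed.

Lemma Ck_on_sub (V : normedModType R) k U W (f : E -> V) :
  W `<=` U -> Ck_on k U f -> Ck_on k W f.
Proof.
by move=> sWU hf; apply: Ck_on_local => x /sWU Ux; exists U.
Qed.

Lemma Ck_on_cst (V : normedModType R) k U (a : V) : Ck_on k U (fun=> a).
Proof.
elim: k a => [|k IH] a /=; first by move=> x _; exact: cst_continuous.
split=> [x _|v]; first exact: differentiable_cst.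
have -> : (fun x => 'D_v (fun=> a) x) = fun=> 0 :> V.
  by apply/funext => x; exact: derive_cst.
exact: IH.
Qed.

Lemma Ck_on_add (V : normedModType R) k U (f g : E -> V) : open U ->
  Ck_on k U f -> Ck_on k U g -> Ck_on k U (fun x => f x + g x).
Proof.
move=> oU; elim: k f g => [|k IH] f g /=.
  by move=> cf cg x Ux; exact: cvgD (cf x Ux) (cg x Ux).
move=> [df Df] [dg Dg]; split=> [x Ux|v].
  by apply: differentiableD; [exact: df|exact: dg].
apply: Ck_on_ext (IH _ _ (Df v) (Dg v)) => // x Ux.
by rewrite -[RHS]/('D_v (f + g) x) deriveD //; apply: diff_derivable;
  [exact: df|exact: dg].
Qed.

(** By the Leibniz rule, the derivatives of a product are again sums of
    products, of one order less. *)
Lemma Ck_on_mul k U (f g : E -> R^o) : open U ->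
  Ck_on k U f -> Ck_on k U g -> Ck_on k U (fun x => (f x * g x : R^o)).
Proof.
move=> oU; elim: k f g => [|k IH] f g /=.
  by move=> cf cg x Ux; exact: cvgM (cf x Ux) (cg x Ux).
move=> [df Df] [dg Dg]; split=> [x Ux|v].
  by apply: differentiableM; [exact: df|exact: dg].
have Cf : Ck_on k U f by apply: Ck_onS.
have Cg : Ck_on k U g by apply: Ck_onS.
apply: Ck_on_ext (Ck_on_add oU (IH _ _ Cf (Dg v)) (IH _ _ Cg (Df v)))
  => // x Ux.
rewrite -[RHS]/('D_v (f * g) x) deriveM //; apply: diff_derivable;
  [exact: df|exact: dg].
Qed.
End Ck.

Section MatrixDerivative.
Context {R : realType} {V : normedModType R}.

Lemma differentiable_entry m n (A : V -> 'M[R]_(m, n)) x i j :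
  differentiable A x -> differentiable (fun y => A y i j : R^o) x.
Proof.
move=> dA; have := differentiable_comp dA (differentiable_coord (A x) i j).
exact.
Qed.

Lemma derive_entry m n (A : V -> 'M[R]_(m, n)) x v i j :
  differentiable A x -> 'D_v A x i j = 'D_v (fun y => A y i j : R^o) x.
Proof. by move=> dA; rewrite derive_mx ?mxE //; exact: diff_derivable. Qed.

Lemma mx_sum_entries m n (A : V -> 'M[R]_(m, n)) :
  A = \sum_(i < m) \sum_(j < n) (fun y => (A y i j) *: delta_mx i j).
Proof.
apply/funext => y; rewrite fct_sumE [LHS]matrix_sum_delta.
by apply: eq_bigr => i _; rewrite fct_sumE.
Qed.

Lemma differentiable_mx m n (A : V -> 'M[R]_(m, n)) x :
  (forall i j, differentiable (fun y => A y i j : R^o) x) -> differentiable A x.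
Proof.
move=> dA; rewrite (mx_sum_entries A); apply: differentiable_sum => i.
by apply: differentiable_sum => j; apply: differentiableZl.
Qed.

Lemma continuous_mx m n (A : V -> 'M[R]_(m, n)) x :
  (forall i j, {for x, continuous (fun y => A y i j : R^o)}) ->
  {for x, continuous A}.
Proof.
move=> cA; rewrite /prop_for /continuous_at.
apply/cvgrPdist_le => /= e e0; near=> y.
rewrite /Num.Def.normr/= mx_normrE (bigmax_le _ (ltW e0))//= => i _.
rewrite !mxE/=.
move: i; near: y; apply: filter_forall => /= i.
by have /cvgrPdist_le := cA i.1 i.2; apply.
Unshelve. all: by end_near. Qed.

Lemma derive_mulmx m n p (A : V -> 'M[R]_(m, n)) (B : V -> 'M[R]_(n, p)) x v :
  differentiable A x -> differentiable B x ->
  'D_v (fun y => A y *m B y) x = 'D_v A x *m B x + A x *m 'D_v B x.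
Proof.
move=> dA dB; have dAe i j := @diff_derivable _ _ _ _ _ v
  (differentiable_entry i j dA).
have dBe i j := @diff_derivable _ _ _ _ _ v (differentiable_entry i j dB).
have eAB i j : (fun y => (A y *m B y) i j : R^o) =
    \sum_k ((fun y => A y i k : R^o) * (fun y => B y k j : R^o)).
  by apply/funext => y; rewrite mxE fct_sumE.
rewrite derive_mx; last first.
  apply/derivable_mxP => i j; rewrite eAB; apply: derivable_sum => k.
  by apply: derivableM.
apply/matrixP => i j; rewrite !mxE eAB derive_sum => [|k];
  last exact: derivableM.
rewrite -big_split; apply: eq_bigr => k _.
rewrite deriveM // !derive_entry //=.
by rewrite addrC; congr (_ + _); rewrite mulrC.
Qed.

Lemma differentiable_mulmx m n p (A : V -> 'M[R]_(m, n)) (B : V -> 'M[R]_(n, p))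
  x :
  differentiable A x -> differentiable B x ->
    differentiable (fun y => A y *m B y) x.
Proof.
move=> dA dB; apply: differentiable_mx => i j.
have -> : (fun y => (A y *m B y) i j : R^o) =
    \sum_k ((fun y => A y i k : R^o) * (fun y => B y k j : R^o)).
  by apply/funext => y; rewrite mxE fct_sumE.
apply: differentiable_sum => k.
by apply: differentiableM; apply: differentiable_entry.
Qed.

Lemma differentiable_trmx m n (F : V -> 'M[R]_(m, n)) x :
  differentiable F x -> differentiable (fun y => (F y)^T) x.
Proof.
move=> dF; apply: differentiable_mx => i j.
have -> : (fun y => (F y)^T i j : R^o) = (fun y => F y j i : R^o).
  by apply/funext => y; rewrite mxE.
exact: differentiable_entry.
Qed.

Lemma derive_trmx m n (F : V -> 'M[R]_(m, n)) x v :
  differentiable F x -> 'D_v (fun y => (F y)^T) x = ('D_v F x)^T.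
Proof.
move=> dF; apply/matrixP => i j;
  rewrite (derive_entry _ _ _ (differentiable_trmx dF)).
rewrite mxE (derive_entry v j i dF); congr ('D_v _ x).
by apply/funext => y; rewrite mxE.
Qed.

Lemma derive_trdot n (A : 'M[R]_n) (F : V -> 'M[R]_n) x v :
  differentiable F x ->
  'D_v (fun y => trdot A (F y) : R^o) x = trdot A ('D_v F x).
Proof.
move=> dF; have -> : (fun y => trdot A (F y) : R^o) =
    \sum_i \sum_j (A i j *: (fun y => F y i j : R^o)).
  by apply/funext => y; rewrite trdotE fct_sumE; apply: eq_bigr => i _;
    rewrite fct_sumE.
have dFe i j : derivable (fun y => F y i j : R^o) x v.
  exact/diff_derivable/differentiable_entry.
have dS i : derivable (\sum_j (A i j *: (fun y => F y i j : R^o))) x v.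
  by apply: derivable_sum => j; apply: derivableZ.
rewrite derive_sum // trdotE; apply: eq_bigr => i _.
rewrite derive_sum => [|j]; last exact: derivableZ.
by apply: eq_bigr => j _; rewrite deriveZ // (derive_entry v i j dF).
Qed.

End MatrixDerivative.

Section Smooth.
Context {R : realType}.
Local Notation E := 'cV[R]_16.
Implicit Types (U : set E).

Lemma Ck_on_entry k U m n (A : E -> 'M[R]_(m, n)) i j : open U ->
  Ck_on k U A -> Ck_on k U (fun y => A y i j : R^o).
Proof.
move=> oU; elim: k A => [|k IH] A /=.
  move=> cA x /cA cAx; rewrite /prop_for /continuous_at.
  exact: cvg_comp cAx (@coord_continuous _ _ _ i j (A x)).
move=> [dA DA]; split=> [x Ux|v]; first exact/differentiable_entry/dA.
apply: Ck_on_ext (IH _ (DA v)) => // x Ux.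
by rewrite derive_entry //; exact: dA.
Qed.

Lemma Ck_on_mx k U m n (A : E -> 'M[R]_(m, n)) : open U ->
  (forall i j, Ck_on k U (fun y => A y i j : R^o)) -> Ck_on k U A.
Proof.
move=> oU; elim: k A => [|k IH] A hA /=.
  by move=> x Ux; apply: continuous_mx => i j; exact: (hA i j).
have dA x : U x -> differentiable A x.
  by move=> Ux; apply: differentiable_mx => i j; exact: (hA i j).1.
split=> // v; apply: IH => i j; apply: Ck_on_ext ((hA i j).2 v) => // x Ux.
by rewrite derive_entry //; exact: dA.
Qed.

Lemma smooth_mx U m n (A : E -> 'M[R]_(m, n)) : open U ->
  (forall i j, smooth_on U (fun y => A y i j : R^o)) -> smooth_on U A.
Proof. by move=> oU hA k; apply: Ck_on_mx => // i j; exact: hA. Qed.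

Lemma smooth_entry U m n (A : E -> 'M[R]_(m, n)) i j : open U ->
  smooth_on U A -> smooth_on U (fun y => A y i j : R^o).
Proof. by move=> oU hA k; apply: Ck_on_entry. Qed.

Lemma smooth_ext (V : normedModType R) U (f g : E -> V) : open U ->
  (forall x, U x -> f x = g x) -> smooth_on U f -> smooth_on U g.
Proof. by move=> oU fg hf k; apply: Ck_on_ext (hf k). Qed.

Lemma smooth_sub (V : normedModType R) U W (f : E -> V) :
  W `<=` U -> smooth_on U f -> smooth_on W f.
Proof. by move=> WU hf k; apply: Ck_on_sub (hf k). Qed.

Lemma smooth_local (V : normedModType R) U (f : E -> V) :
  (forall x, U x -> exists W, W x /\ smooth_on W f) -> smooth_on U f.
Proof.
by move=> h k; apply: Ck_on_local => x /h[W [Wx hW]]; exists W; split.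
Qed.

Lemma smooth_cst (V : normedModType R) U (a : V) : smooth_on U (fun=> a).
Proof. by move=> k; apply: Ck_on_cst. Qed.

Lemma smooth_add (V : normedModType R) U (f g : E -> V) : open U ->
  smooth_on U f -> smooth_on U g -> smooth_on U (fun x => f x + g x).
Proof. by move=> oU hf hg k; apply: Ck_on_add. Qed.

Lemma smooth_mul U (f g : E -> R^o) : open U ->
  smooth_on U f -> smooth_on U g -> smooth_on U (fun x => (f x * g x : R^o)).
Proof. by move=> oU hf hg k; apply: Ck_on_mul. Qed.

Lemma smooth_sum (V : normedModType R) U (J : Type) (r : seq J) (Q : pred J)
  (F : J -> E -> V) :
  open U -> (forall j, smooth_on U (F j)) ->
  smooth_on U (fun x => \sum_(j <- r | Q j) F j x).
Proof.
move=> oU hF; elim: r => [|j r IH].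
  by apply: smooth_ext (smooth_cst U 0) => // x _; rewrite big_nil.
have [Pj|Pj] := boolP (Q j).
  by apply: smooth_ext (smooth_add oU (hF j) IH) => // x _; rewrite big_cons Pj.
by apply: smooth_ext IH => // x _; rewrite big_cons (negPf Pj).
Qed.

Lemma smooth_mulmx U m n p (A : E -> 'M[R]_(m, n)) (B : E -> 'M[R]_(n, p)) :
  open U -> smooth_on U A -> smooth_on U B -> smooth_on U (fun x => A x *m B x).
Proof.
move=> oU hA hB; apply: smooth_mx => // i j.
apply: smooth_ext (@smooth_sum R^o U _ (index_enum (ordinal n)) xpredT
  (fun k x => (A x i k * B x k j : R^o)) oU _) => // [x _|k].
  by rewrite mxE.
by apply: smooth_mul => //; apply: smooth_entry.
Qed.

Lemma smooth_trmx U m n (A : E -> 'M[R]_(m, n)) : open U ->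
  smooth_on U A -> smooth_on U (fun x => (A x)^T).
Proof.
move=> oU hA; apply: smooth_mx => // i j.
by apply: smooth_ext (smooth_entry j i oU hA) => // x _; rewrite mxE.
Qed.

Lemma smooth_derive (V : normedModType R) U (f : E -> V) v :
  smooth_on U f -> smooth_on U (fun x => 'D_v f x).
Proof. by move=> hf k; have [_] := hf k.+1; apply. Qed.

Lemma smooth_differentiable (V : normedModType R) U (f : E -> V) x :
  smooth_on U f -> U x -> differentiable f x.
Proof. by move=> hf Ux; have [h _] := hf 1%N; exact: h. Qed.

Lemma derive_basis (V : normedModType R) (f : E -> V) x v :
  differentiable f x -> 'D_v f x = \sum_c v c 0 *: 'D_(basis c) f x.
Proof.
move=> df; rewrite deriveE // {1}[v]matrix_sum_delta linear_sum.
by apply: eq_bigr => c _; rewrite big_ord1 linearZ deriveE.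
Qed.
End Smooth.

Section SmoothLinear.
Context {R : realType}.
Local Notation E := 'cV[R]_16.
Implicit Types (U : set E).

Lemma smooth_scale U (f : E -> R^o) m n (B : 'M[R]_(m, n)) : open U ->
  smooth_on U f -> smooth_on U (fun y => (f y : R) *: B).
Proof.
move=> oU hf; apply: smooth_mx => // i j.
apply: smooth_ext (smooth_mul oU hf (smooth_cst (V := R^o) U (B i j)))
  => // x _.
by rewrite mxE.
Qed.

Lemma smooth_lfun U (L : 'End('M[R]_16)) (A : E -> 'M[R]_16) : open U ->
  smooth_on U A -> smooth_on U (fun y => L (A y)).
Proof.
move=> oU hA.
apply: (@smooth_ext _ _ U (fun y => \sum_i \sum_j (A y i j)
  *: L (delta_mx i j))) => //.
  move=> y _; rewrite [in RHS](matrix_sum_delta (A y)) linear_sum.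
  by apply: eq_bigr => i _; rewrite linear_sum; apply: eq_bigr => j _;
    rewrite linearZ.
apply: smooth_sum => // i; apply: smooth_sum => // j.
by apply: smooth_scale => //; apply: smooth_entry.
Qed.

Lemma hom_sum (gam : @homtype R) :
  gam = \sum_q \sum_r \sum_s hom_coef gam q r s *:
    hom_of_coef (fun q' r' s' => ((q' == q) && (r' == r) && (s' == s))%:R).
Proof.
apply: hom_coef_inj => a b c; rewrite {2}/hom_coef.
rewrite sum_lfunE summxE (bigD1 a) //= [X in _ + X]big1 ?addr0; last first.
  move=> q qa; rewrite sum_lfunE summxE big1 // => r _.
  rewrite sum_lfunE summxE big1 // => s _.
  rewrite scale_lfunE mxE -/(hom_coef _ _ _ _) hom_of_coefK.
  by rewrite eq_sym (negPf qa) mulr0.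
rewrite sum_lfunE summxE (bigD1 b) //= [X in _ + X]big1 ?addr0; last first.
  move=> r rb; rewrite sum_lfunE summxE big1 // => s _.
  rewrite scale_lfunE mxE -/(hom_coef _ _ _ _) hom_of_coefK.
  by rewrite [b == r]eq_sym (negPf rb) andbF mulr0.
rewrite sum_lfunE summxE (bigD1 c) //= big1 ?addr0; last first.
  move=> s sc; rewrite scale_lfunE mxE -/(hom_coef _ _ _ _) hom_of_coefK.
  by rewrite [c == s]eq_sym (negPf sc) andbF mulr0.
by rewrite scale_lfunE mxE -/(hom_coef _ _ _ _) hom_of_coefK !eqxx mulr1.
Qed.

(** Smoothness of a family of linear maps is expressed through its values on the
    basis; a linear operator acts on these by constant coefficients. *)
Lemma smooth_hom_lfun U (L : 'End(@homtype R)) (G : E -> @homtype R) : open U ->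
  (forall q, smooth_on U (fun y => G y (basis q))) ->
  forall q, smooth_on U (fun y => L (G y) (basis q)).
Proof.
move=> oU hG q.
apply: (@smooth_ext _ _ U (fun y => \sum_a \sum_b \sum_c hom_coef (G y) a b c *:
   L (hom_of_coef (fun q' r' s' => ((q' == a) && (r' == b) && (s' == c))%:R))
     (basis q))) => //.
  move=> y _; rewrite [in RHS](hom_sum (G y)) !linear_sum sum_lfunE.
  apply: eq_bigr => a _; rewrite !linear_sum sum_lfunE.
  apply: eq_bigr => b _; rewrite !linear_sum sum_lfunE.
  by apply: eq_bigr => c _; rewrite linearZ scale_lfunE.
do 3!(apply: smooth_sum => // ?).
by apply: smooth_scale => //; apply: (smooth_entry _ _ oU (hG _)).
Qed.

Lemma smooth_hom_apply U (G : E -> @homtype R) (w : E -> E) : open U ->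
  (forall q, smooth_on U (fun y => G y (basis q))) -> smooth_on U w ->
  smooth_on U (fun y => G y (w y)).
Proof.
move=> oU hG hw; apply: smooth_mx => // r s.
apply: (@smooth_ext _ _ U (fun y
  => \sum_q (w y q 0 * hom_coef (G y) q r s : R^o))) => //.
  by move=> y _; rewrite [RHS]hom_coefE.
apply: smooth_sum => // q; apply: smooth_mul => //; first exact: smooth_entry.
exact: smooth_entry.
Qed.
End SmoothLinear.

(** * Charts, fields and connections *)

Lemma sum_basis (R : realType) (v : 'cV[R]_16) : v = \sum_c v c 0 *: basis c.
Proof.
by rewrite {1}[v]matrix_sum_delta; apply: eq_bigr => c _; rewrite big_ord1.
Qed.

Section Charts.
Context {R : realType} (M : oriented_manifold R).
Local Notation E := 'cV[R]_16.

(** Near a point of the image, being in the image of the domain and being mapped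
    into W by the inverse chart are both open conditions. *)
Lemma chart_img_open (i : idx M) (W : set M) : open W ->
  open (chart i @` (W `&` dom i)).
Proof.
move=> oW; rewrite openE => y [p [Wp dp] <-] /=.
have n1 : \forall y \near chart i p, (chart i @` dom i) y.
  by apply: open_nbhs_nbhs; split; [exact: chart_open | exists p].
have n2 : \forall y \near chart i p, W (cinv i y).
  apply: (cinv_continuous dp); rewrite chartK //.
  by apply: open_nbhs_nbhs.
apply: filterS2 n1 n2 => z [q dq <-]; rewrite chartK // => Wq.
by exists q.
Qed.

Lemma chart_imgP (i : idx M) (W : set M) y : (chart i @` (W `&` dom i)) y ->
  [/\ W (cinv i y), dom i (cinv i y) & chart i (cinv i y) = y].
Proof. by case=> p [Wp dp] <-; rewrite chartK. Qed.

Lemma trans_unit (i j : idx M) p : dom i p -> dom j p ->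
  trans i j p \in unitmx.
Proof.
move=> di dj; have := transition_oriented di dj.
by rewrite unitmxE unitfE lt0r => /andP[].
Qed.

Lemma fields_differentiable k (W : set M) (X : idx M -> M -> 'M[R]_(16, k.+1)) i
  p :
  local_fields W X -> W p -> dom i p ->
    differentiable (X i \o cinv i) (chart i p).
Proof.
move=> [_ hX] Wp dp; apply: smooth_differentiable (hX i) _.
by exists p.
Qed.

Lemma fields_mulmx k l (W : set M) (X : idx M -> M -> 'M[R]_(16, k.+1))
    (c : 'M[R]_(k.+1, l.+1)) : open W ->
  local_fields W X -> local_fields W (fun i p => X i p *m c).
Proof.
move=> oW [h1 h2]; split=> [i j p Wp di dj|i];
  first by rewrite (h1 i j) // mulmxA.
have oU := chart_img_open (i := i) oW.
by apply: smooth_mulmx => //; [exact: h2 | exact: smooth_cst].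
Qed.

Lemma dchart_mulmx k l (W : set M) (X : idx M -> M -> 'M[R]_(16, k.+1))
    (c : 'M[R]_(k.+1, l.+1)) i p v :
  local_fields W X -> W p -> dom i p ->
  dchart i (fun p => X i p *m c) p v = dchart i (X i) p v *m c.
Proof.
move=> hX Wp dp; have dX := fields_differentiable hX Wp dp.
have dc : differentiable (cst c : E -> _) (chart i p)
  by exact: differentiable_cst.
rewrite /dchart -[LHS]/('D_v (fun y => (X i \o cinv i) y *m cst c y)
  (chart i p)).
by rewrite (derive_mulmx v dX dc) derive_cst mulmx0 addr0.
Qed.

Lemma fields_locally_constant (V : normedModType R) (W : set M) (i : idx M)
  (f : M -> V) p v a :
  open W -> W p -> dom i p -> (forall q, W q -> dom i q -> f q = a) ->
  dchart i f p v = 0.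
Proof.
move=> oW Wp dp hf; rewrite /dchart -[RHS](derive_cst a (chart i p) v).
apply: near_eq_derive; have oU := chart_img_open (i := i) oW.
have : \forall y \near chart i p, (chart i @` (W `&` dom i)) y.
  by apply: open_nbhs_nbhs; split=> //; exists p.
by apply: filterS => y /chart_imgP[Wy dy _]; apply: hf.
Qed.
End Charts.

Section Connections.
Context {R : realType} (M : oriented_manifold R).
Local Notation E := 'cV[R]_16.
Implicit Types (D : connection M) (W : set M).

Definition christoffel_along D (i : idx M) p (v : E) : 'M[R]_16 :=
  \sum_(c < 16) v c 0 *: christoffel D i p c.

Lemma christoffel_along_linear D i p : linear (christoffel_along D i p).
Proof.
move=> k x y; rewrite /christoffel_along scaler_sumr -big_split.
by apply: eq_bigr => c _; rewrite !mxE scalerDl scalerA.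
Qed.

Lemma nablaE D k i (X : idx M -> M -> 'M[R]_(16, k.+1)) p v :
  nabla D i X p v = dchart i (X i) p v + christoffel_along D i p v *m X i p.
Proof. by []. Qed.

Lemma nabla_mulmx D k l W (X : idx M -> M -> 'M[R]_(16, k.+1))
    (c : 'M[R]_(k.+1, l.+1)) i p v :
  local_fields W X -> W p -> dom i p ->
  nabla D i (fun i p => X i p *m c) p v = nabla D i X p v *m c.
Proof.
by move=> hX Wp dp; rewrite !nablaE (dchart_mulmx c v hX) // mulmxDl mulmxA.
Qed.

Lemma mulmx_basis_inj m (A B : 'M[R]_(m, 16)) :
  (forall c, A *m basis c = B *m basis c) -> A = B.
Proof.
move=> h; apply/matrixP => a b; have := h b.
by rewrite /basis -!colE => /matrixP/(_ a 0); rewrite !mxE.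
Qed.

(** Apply the transformation law of covariant derivatives to each column of the
    frame, that is, to the vector fields e *m basis c. *)
Lemma nabla_trans D W (e : idx M -> M -> 'M[R]_16) i j p v : open W ->
  local_fields (k := 15%N) W e -> W p -> dom i p -> dom j p ->
  nabla D (k := 15%N) j e p (trans i j p *m v) = trans i j p
    *m nabla D (k := 15%N) i e p v.
Proof.
move=> oW he Wp di dj; apply: mulmx_basis_inj => c.
have hv : vector_field W (fun i p => e i p *m basis c).
  exact: (fields_mulmx (k := 15%N) (l := 0%N) (basis c) oW he).
have := covd_trans D oW hv v Wp di dj.
rewrite -/(nabla D (k := 0%N) j _ p _) -/(nabla D (k := 0%N) i _ p _).
rewrite (nabla_mulmx D (k := 15%N) (l := 0%N) (basis c) _ he Wp dj).
by rewrite (nabla_mulmx D (k := 15%N) (l := 0%N) (basis c) _ he Wp di) mulmxA.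
Qed.

Lemma connform_trans D W (e : idx M -> M -> 'M[R]_16) i j p v : open W ->
  local_fields (k := 15%N) W e -> W p -> dom i p -> dom j p ->
  e i p \in unitmx ->
  connform D e j p (trans i j p *m v) = connform D e i p v.
Proof.
move=> oW he Wp di dj ue; have ut := trans_unit di dj.
rewrite /connform (nabla_trans D v oW he) //.
have -> : e j p = trans i j p *m e i p by case: he => h _; exact: h.
have ute : trans i j p *m e i p \in unitmx by rewrite unitmx_mul ut.
apply: (can_inj (mulKmx ute)); rewrite (mulKVmx ute) -mulmxA; congr (_ *m _).
by rewrite (mulKVmx ue).
Qed.

Lemma connform_linear D W (e : idx M -> M -> 'M[R]_16) i p :
  local_fields (k := 15%N) W e -> W p -> dom i p -> linear (connform D e i p).
Proof.
move=> he Wp dp k x y; have de := fields_differentiable (k := 15%N) he Wp dp.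
rewrite /connform !nablaE christoffel_along_linear /dchart !(deriveE _ de)
  linearP.
rewrite scalemxAr -mulmxDr; congr (_ *m _).
by rewrite mulmxDl scalerDr -scalemxAl addrACA.
Qed.
End Connections.

Section ThreeFormScaling.
Context {R : realType} (M : oriented_manifold R).

Lemma three_formZ (k : R) (mu : three_tensor M) : three_form mu ->
  three_form (fun i p x y z => k * mu i p x y z).
Proof.
move=> [h1 h2 h3]; split.
- move=> i p dp; have [l s1 s2] := h1 i p dp; split=> [r x x' y z|x y z|x y z].
  + by rewrite l; ring.
  + by rewrite s1 mulrN.
  + by rewrite s2 mulrN.
- by move=> i j p di dj x y z; rewrite (h2 i j p di dj).
- move=> i a b c.
  have oU : open (chart i @` (dom i `&` dom i)) by apply: chart_img_open;
    exact: dom_open.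
  exact: (smooth_mul oU (smooth_cst (V := R^o) _ k) (h3 i a b c)).
Qed.

End ThreeFormScaling.

(** * Adapted frames *)

Section Dot.
Context {R : realType}.
Local Notation E := 'cV[R]_16.
Implicit Types (x y z : E) (gam : @homtype R).

Lemma dotmxDl x y z : dotmx (x + y) z = dotmx x z + dotmx y z.
Proof. by rewrite /dotmx linearD mulmxDl mxE. Qed.

Lemma dotmxNl x y : dotmx (- x) y = - dotmx x y.
Proof. by rewrite /dotmx linearN mulNmx mxE. Qed.

Lemma dotmxC x y : dotmx x y = dotmx y x.
Proof. by rewrite /dotmx !mxE; apply: eq_bigr => i _; rewrite !mxE mulrC. Qed.

Lemma dotmx_basis x i : dotmx x (basis i) = x i 0.
Proof. by rewrite /dotmx /basis -colE !mxE. Qed.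

Lemma dotmx_inj x y : (forall z, dotmx x z = dotmx y z) -> x = y.
Proof.
move=> h; apply/matrixP => i j; rewrite ord1 -!dotmx_basis; exact: h.
Qed.

Lemma dotmx_mul (A : 'M[R]_16) x y : dotmx (A *m x) y = dotmx x (A^T *m y).
Proof. by rewrite /dotmx trmx_mul mulmxA. Qed.

Lemma dotmx_skew (A : 'M[R]_16) x y : A^T = - A ->
  dotmx (A *m x) y = - dotmx (A *m y) x.
Proof. by move=> hA; rewrite dotmx_mul hA mulNmx dotmxC dotmxNl. Qed.

(** Put K(x, y, z) = <gam(x) y, z>, skew in y and z. Skewness in y and z of K(x,
    y, z) - K(y, x, z) makes K invariant under cyclic permutations, and a cyclic
    K that is skew in its last two arguments is alternating. *)
Lemma skew_torsion_alternating gam : (forall x, (gam x)^T = - gam x) ->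
  (forall x y z, dotmx (gam x *m z - gam z *m x) y
    = - dotmx (gam x *m y - gam y *m x) z) ->
  alternating3 gam.
Proof.
move=> hs ht; split=> // x y; apply: dotmx_inj => z; rewrite dotmxNl.
have cyc a b c : dotmx (gam a *m b) c = dotmx (gam c *m a) b.
  have := ht b a c; rewrite !dotmxDl !dotmxNl.
  have := dotmx_skew b c (hs a); have := dotmx_skew a b (hs c).
  have := dotmx_skew a c (hs b); lra.
by rewrite (cyc y x z) (cyc z y x) dotmx_skew.
Qed.
End Dot.

Section Frames.
Context {R : realType} (M : oriented_manifold R) (g : metric M).
Context (I : 'I_9 -> 'M[R]_16) (hI : spin9_generators I)
  (S : spin9_structure g I).
Local Notation E := 'cV[R]_16.
Implicit Types (D : connection M) (W : set M) (e : idx M -> M -> 'M[R]_16).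

Lemma adapted_frame_at p : exists W e, adapted_frame S W e /\ W p.
Proof.
have [W [e [oW Wp he hr]]] := red_section S p.
by exists W, e; split=> //; split.
Qed.

Section AtPoint.
Variables (W : set M) (e : idx M -> M -> 'M[R]_16) (i : idx M) (p : M).
Hypotheses (he : adapted_frame S W e) (Wp : W p) (dp : dom i p).

Lemma frame_orthonormal : (e i p)^T *m gmx g i p *m e i p = 1%:M.
Proof. by case: he => _ _ hr; have [] := red_frame dp (hr _ _ Wp dp). Qed.

Lemma frame_unit : e i p \in unitmx.
Proof. by have [] := mulmx1_unit frame_orthonormal. Qed.

Lemma frame_invE : invmx (e i p) = (e i p)^T *m gmx g i p.
Proof.
by rewrite -[RHS]mulmx1 -(mulmxV frame_unit) mulmxA frame_orthonormal mul1mx.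
Qed.

Lemma gdot_frame x y : gdot g i p (e i p *m x) (e i p *m y) = dotmx x y.
Proof.
rewrite /gdot /dotmx trmx_mul !mulmxA -(mulmxA x^T) -(mulmxA x^T).
by rewrite frame_orthonormal mulmx1.
Qed.

(** The scalar products of the columns of an adapted frame are constant, so the
    derivative of the metric along them gives zero. *)
Lemma connform_skew D v : metric_connection g D ->
  (connform D e i p v)^T = - connform D e i p v.
Proof.
move=> hD; have [oW hf hr] := he.
set N := nabla D (k := 15%N) i e p v.
have eN : connform D e i p v = (e i p)^T *m gmx g i p *m N
  by rewrite /connform frame_invE.
have hv c : vector_field W (fun i p => e i p *m basis c).
  exact: (fields_mulmx (k := 15%N) (l := 0%N) (basis c) oW hf).
suff h a b : (N^T *m gmx g i p *m e i p) a b = - (connform D e i p v) a b.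
  apply/matrixP => a b; rewrite -[in RHS]/((- connform D e i p v) a b) [RHS]mxE
    -h eN.
  by rewrite !trmx_mul trmxK (gmx_sym g dp) mulmxA.
have := hD W _ _ oW (hv a) (hv b) i p v Wp dp.
rewrite (fields_locally_constant (V := R^o) v (a := dotmx (basis a) (basis b))
  oW Wp dp); last first.
  move=> q Wq dq; case: (he) => _ _ hrq; rewrite /gdot /dotmx trmx_mul !mulmxA.
  have [on _] := red_frame dq (hrq _ _ Wq dq).
  by rewrite -(mulmxA (basis a)^T) -(mulmxA (basis a)^T) on mulmx1.
have eY c : nabla D (k := 0%N) i (fun i p => e i p *m basis c) p v = N
  *m basis c.
  exact: (nabla_mulmx D (k := 15%N) (l := 0%N) (basis c) v hf Wp dp).
move=> h0; have {h0} : 0 = gdot g i p (N *m basis a) (e i p *m basis b)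
    + gdot g i p (e i p *m basis a) (N *m basis b) by rewrite -!eY; exact: h0.
have gE (A B : 'M[R]_16) : gdot g i p (A *m basis a) (B *m basis b)
    = (A^T *m gmx g i p *m B) a b.
  by rewrite /gdot /basis trmx_mul trmx_delta -!mulmxA -rowE !mulmxA -colE !mxE.
by rewrite !gE eN => /esym/eqP; rewrite addr_eq0 => /eqP.
Qed.
End AtPoint.

Lemma Gamma_E D W e i p x : local_fields (k := 15%N) W e -> W p -> dom i p ->
  Gamma I D e i p x = pr_m I (connform D e i p (e i p *m x)).
Proof.
move=> hf Wp dp; rewrite /Gamma linfunE // => k y z.
by rewrite mulmxDr -scalemxAr (connform_linear D hf Wp dp) linearP.
Qed.
End Frames.

(** * Connections with skew torsion in an adapted frame *)

Section Difference.
Context {R : realType} (M : oriented_manifold R) (g : metric M).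
Context (I : 'I_9 -> 'M[R]_16) (hI : spin9_generators I)
  (S : spin9_structure g I).
Local Notation E := 'cV[R]_16.
Implicit Types (D : connection M) (W : set M) (e : idx M -> M -> 'M[R]_16).

Lemma preserves_skew D W e i p v : preserves S D -> adapted_frame S W e ->
  W p -> dom i p -> (connform D e i p v)^T = - connform D e i p v.
Proof.
by move=> hD he Wp dp; apply: (spin9_skew hI); apply: hD he _ _ _ Wp dp.
Qed.

(** The difference of two connections, read in the frame e: a tensor, as
    derivatives of e cancel. *)
Definition frame_diff D D' e (i : idx M) p : @homtype R :=
  linfun (fun x : E => connform D e i p (e i p *m x)
    - connform D' e i p (e i p *m x)).

Lemma frame_diffE D D' W e i p x : local_fields (k := 15%N) W e -> W p ->
  dom i p ->
  frame_diff D D' e i p x = connform D e i p (e i p *m x)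
    - connform D' e i p (e i p *m x).
Proof.
move=> hf Wp dp; rewrite /frame_diff linfunE // => k y z.
rewrite mulmxDr -scalemxAr (connform_linear D hf Wp dp)
  (connform_linear D' hf Wp dp).
by rewrite scalerBr opprD addrACA.
Qed.

Lemma mul_frame_diff D D' W e i p x : adapted_frame S W e -> W p -> dom i p ->
  e i p *m frame_diff D D' e i p x =
  (christoffel_along D i p (e i p *m x) - christoffel_along D' i p (e i p *m x))
    *m e i p.
Proof.
move=> he Wp dp; have [_ hf _] := he;
  rewrite (frame_diffE D D' x hf Wp dp) mulmxBr.
rewrite /connform !(mulKVmx (frame_unit he Wp dp)) !nablaE mulmxBl.
by rewrite opprD addrACA subrr add0r.
Qed.

(** In the torsion of D minus that of LC, which is zero, all the terms with
    derivatives of the fields cancel. *)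
Lemma torsion_diff D LC W (X Y : idx M -> M -> E) i p : torsion_free LC ->
  open W -> vector_field W X -> vector_field W Y -> W p -> dom i p ->
  torsion D i X Y p =
   (christoffel_along D i p (X i p) - christoffel_along LC i p (X i p)) *m Y i p
   - (christoffel_along D i p (Y i p) - christoffel_along LC i p (Y i p))
     *m X i p.
Proof.
move=> tf oW hX hY Wp dp; have h := tf W X Y oW hX hY i p Wp dp.
(* Here a, b are the derivatives of Y, X along X, Y; the other letters are the
   Christoffel terms. *)
have abs (a b c d u w : E) : (a + c - (b + d) - (a - b))
  - (a + u - (b + w) - (a - b))
    = (c - u) - (d - w).
  by apply/matrixP => r s; rewrite !mxE; ring.
rewrite -[LHS]subr0 -h /torsion !nablaE !mulmxBl; exact: abs.
Qed.

(** Both connections are metric, so k has skew values; its antisymmetrization is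
    the torsion. The m-part of k is that of - LC since D has none. *)
Lemma skew_torsion_frame D LC T W e i p : preserves S D -> three_form T ->
  torsion_form g D T -> levi_civita g LC -> adapted_frame S W e -> W p ->
    dom i p ->
  let k := frame_diff D LC e i p in
  [/\ alternating3 k,
      forall x y z, T i p (e i p *m x) (e i p *m y) (e i p *m z)
        = 2 * dotmx (k x *m y) z
    & Theta I k = - Gamma I LC e i p].
Proof.
move=> hD hT htor [hmet htf] he Wp dp k; have [oW hf hr] := he.
have hk x : (k x)^T = - k x.
  rewrite /k (frame_diffE D LC x hf Wp dp) linearB /=
    (preserves_skew _ hD he Wp dp).
  by rewrite (connform_skew he Wp dp _ hmet) opprB opprK addrC.
have hv (x : E) : vector_field W (fun i p => e i p *m x).
  exact: (fields_mulmx (k := 15%N) (l := 0%N) x oW hf).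
have tau x y z : T i p (e i p *m x) (e i p *m y) (e i p *m z)
    = dotmx (k x *m y - k y *m x) z.
  rewrite (htor W _ _ _ oW (hv x) (hv y) (hv z) i p Wp dp).
  rewrite (torsion_diff D htf oW (hv x) (hv y) Wp dp) !mulmxA.
  rewrite -!(mul_frame_diff D LC _ he Wp dp) -/k -!mulmxA -mulmxBr.
  exact: gdot_frame he Wp dp _ _.
have [hT3 _ _] := hT; have [_ _ Tskew] := hT3 i p dp.
have hka : alternating3 k.
  by apply: skew_torsion_alternating => // x y z; rewrite -!tau Tskew.
split=> // [x y z|].
  case: hka => _ hka; rewrite tau dotmxDl dotmxNl [in X in _ - X]hka dotmxNl
    opprK.
  by rewrite mulr_natl mulr2n.
apply/lfunP => x; rewrite ThetaE opp_lfunE (Gamma_E I LC x hf Wp dp) /k.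
have hs : connform D e i p (e i p *m x) \in spin9 I by exact: hD he _ _ _ Wp dp.
by rewrite (frame_diffE D LC x hf Wp dp) linearB /= (pr_m_spin9 hI hs) sub0r.
Qed.
End Difference.

(** * Change of adapted frame *)

Section LieAlgebra.
Context {R : realType} (I : 'I_9 -> 'M[R]_16) (hI : spin9_generators I).
Local Notation E := 'cV[R]_16.
Implicit Types (A X h : 'M[R]_16).

Lemma trdot_Ad h A B : Spin9 I h ->
  trdot (h *m A *m h^T) (h *m B *m h^T) = trdot A B.
Proof.
move=> hh; rewrite /trdot Ad_tr -(Ad_mul hh) mxtrace_mulC mulmxA.
by rewrite !mulmxA (Spin9_trl hh) mul1mx.
Qed.

(** The trace form of the two factors is the trace of a word of length 5, and
    there is a letter outside it. *)
Lemma gen4_lin9_orth t a A : a \notin [:: t.1.1; t.1.2; t.2] -> A \in lin9 I ->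
  trdot (gen3 I t *m I a) A = 0.
Proof.
move=> hat /memv_lines[c ->]; rewrite trdot_sum big1 // => b _.
rewrite trdotZ; suff -> : trdot (gen3 I t *m I a) (I b) = 0 by rewrite mulr0.
have -> : gen3 I t *m I a = word I [:: t.1.1; t.1.2; t.2; a].
  by rewrite /gen3 /= mulmx1 !mulmxA.
rewrite /trdot (trmx_word hI) -[I b]mulmx1 -[_ *m 1%:M]/(word I [:: b])
  -word_cat.
set s := _ ++ _; have [c0 hc0] := @fresh9 s isT.
apply: (mxtrace_word0 hI (c := c0)).
have := count_predC (pred1 c0) s.
by rewrite (count_memPn hc0) add0n => ->.
Qed.

(** For a letter a outside the triple t, conjugation by I_a changes the sign of
    I_t = I_b I_c I_d. The hypothesis therefore reads 2 <I_t, X> = 0, and X is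
    orthogonal to m. *)
Lemma normalizer_spin9 X : X^T = - X ->
  (forall t a, triple9 t -> a \notin [:: t.1.1; t.1.2; t.2] ->
     trdot (gen3 I t *m I a) (X *m I a - I a *m X) = 0) ->
  X \in spin9 I.
Proof.
move=> hX h; apply: pr_m_eq0 => //; rewrite pr_mE // big1 // => t ht.
suff -> : trdot (gen3 I t) X = 0 by rewrite mulr0 scale0r.
have [a ha] := @fresh9 [:: t.1.1; t.1.2; t.2] isT.
have := h t a ht ha; rewrite trdotB.
have -> : trdot (gen3 I t *m I a) (X *m I a) = trdot (gen3 I t) X.
  rewrite /trdot trmx_mul (gen_sym hI) -mulmxA mxtrace_mulC -!mulmxA
    (gen_sqr hI).
  by rewrite mulmx1.
have -> : trdot (gen3 I t *m I a) (I a *m X) = - trdot (gen3 I t) X.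
  have e : I a *m (gen3 I t)^T = - ((gen3 I t)^T *m I a).
    rewrite gen3E (trmx_word hI) (gen_word hI).
    have -> : count (predC1 a) (rev [:: t.1.1; t.1.2; t.2]) = 3%N.
      have nr : a \notin rev [:: t.1.1; t.1.2; t.2] by rewrite mem_rev.
      by have := count_predC (pred1 a) (rev [:: t.1.1; t.1.2; t.2]);
        rewrite (count_memPn nr) add0n => ->; rewrite size_rev.
    by rewrite -signr_odd expr1 scaleN1r.
  rewrite /trdot trmx_mul (gen_sym hI) e mulNmx linearN /= -!mulmxA
    (mulmxA (I a)).
  by rewrite (gen_sqr hI) mul1mx.
lra.
Qed.

(** Differentiating h^T h = 1 shows that X = h^T dh is skew. Differentiating the
    membership of h I_a h^T in lin9, tested against h J h^T for J orthogonal to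
    lin9, shows that the commutator of X and I_a is orthogonal to J. With J =
    I_t I_a this is the criterion above. *)
Lemma Spin9_derive (h : E -> 'M[R]_16) x v : differentiable h x ->
  (\forall y \near x, Spin9 I (h y)) -> (h x)^T *m 'D_v h x \in spin9 I.
Proof.
move=> dh hh; have hx : Spin9 I (h x) by apply: nbhs_singleton hh.
have dht := differentiable_trmx dh.
set X := (h x)^T *m 'D_v h x.
have hX : 'D_v h x = h x *m X by rewrite mulmxA (Spin9_trr hx) mul1mx.
have skX : X^T = - X.
  apply/eqP; rewrite -addr_eq0; apply/eqP.
  rewrite {1}/X trmx_mul trmxK -(derive_trmx v dh) -(derive_mulmx v dht dh).
  rewrite -[RHS](derive_cst (1%:M : 'M[R]_16) x v); apply: near_eq_derive.
  by apply: filterS hh => y; exact: Spin9_trl.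
apply: normalizer_spin9 => // t a ht ha.
rewrite -(trdot_Ad _ _ hx); set J := h x *m _ *m _.
have dc : differentiable (cst (I a) : E -> 'M[R]_16) x
  by exact: differentiable_cst.
have dF1 := differentiable_mulmx dh dc.
have dF := differentiable_mulmx dF1 dht.
have -> : h x *m (X *m I a - I a *m X) *m (h x)^T
  = 'D_v (fun y => h y *m cst (I a) y *m (h y)^T) x.
  rewrite (derive_mulmx v dF1 dht) (derive_mulmx v dh dc) derive_cst mulmx0
    addr0.
  rewrite (derive_trmx v dh) hX trmx_mul skX mulmxBr mulmxBl !mulNmx !mulmxN.
  by rewrite !mulmxA.
rewrite -(derive_trdot J v dF) -[RHS](derive_cst (0 : R^o) x v).
apply: near_eq_derive; apply: filterS hh => y hy.
rewrite /J -(trmxK (h x)).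
have hxt := Spin9_tr hx.
rewrite -(trdot_Ad _ _ hxt) trmxK !mulmxA -!(mulmxA _ (h x)^T (h x)).
rewrite !(Spin9_trl hx) !mulmx1 !mul1mx.
apply: gen4_lin9_orth => //.
case: hxt => _ _ hxt; have := hxt (h y *m I a *m (h y)^T); rewrite trmxK.
case: hy => _ _ <-; rewrite gen_lin9 => /esym.
by rewrite /= !mulmxA.
Qed.
End LieAlgebra.

Section Gauge.
Context {R : realType} (M : oriented_manifold R) (g : metric M).
Context (I : 'I_9 -> 'M[R]_16) (hI : spin9_generators I)
  (S : spin9_structure g I).
Local Notation E := 'cV[R]_16.
Implicit Types (D : connection M) (W : set M) (e : idx M -> M -> 'M[R]_16).

(** As e is orthonormal for g, the matrix e^T g is its inverse. *)
Lemma frame_change W W' e e' i p : adapted_frame S W e ->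
  adapted_frame S W' e' ->
  W p -> W' p -> dom i p ->
  let h := (e i p)^T *m gmx g i p *m e' i p in
  Spin9 I h /\ e' i p = e i p *m h.
Proof.
move=> he he' Wp Wp' dp h; have [_ _ hr] := he; have [_ _ hr'] := he'.
have [hh e'E] := (red_torsor dp (hr _ _ Wp dp) (e' i p)).1 (hr' _ _ Wp' dp).
move=> ee'; have -> : h = hh.
  by rewrite /h ee' mulmxA (frame_orthonormal he Wp dp) mul1mx.
by [].
Qed.

(** For e' = e h the connection form is h^T omega h + h^T dh. The second term
    lies in spin(9), and taking m-parts commutes with conjugation by h. *)
Lemma Gamma_gauge D W W' e e' i p : metric_connection g D ->
  adapted_frame S W e -> adapted_frame S W' e' -> W p -> W' p -> dom i p ->
  let h := (e i p)^T *m gmx g i p *m e' i p in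
  Gamma I D e' i p = spin9_act h^T (Gamma I D e i p).
Proof.
move=> hD he he' Wp Wp' dp h0.
have [oW hf _] := he; have [oW' hf' _] := he'.
pose Em := e i \o cinv i; pose Em' := e' i \o cinv i;
  pose Gm := gmx g i \o cinv i.
pose h (y : E) := (Em y)^T *m Gm y *m Em' y.
have oO : open (chart i @` ((W `&` W') `&` dom i)).
  by apply: chart_img_open; exact: openI.
have nO : \forall y \near chart i p, (chart i @` ((W `&` W') `&` dom i)) y.
  by apply: open_nbhs_nbhs; split=> //; exists p.
have hO y : (chart i @` ((W `&` W') `&` dom i)) y ->
  Spin9 I (h y) /\ Em' y = Em y *m h y.
  by move=> /chart_imgP[[Wy Wy'] dy _]; exact: (frame_change he he' Wy Wy' dy).
have dE : differentiable Em (chart i p) :=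
  fields_differentiable (k := 15%N) hf Wp dp.
have dE' : differentiable Em' (chart i p) :=
  fields_differentiable (k := 15%N) hf' Wp' dp.
have dG : differentiable Gm (chart i p).
  by apply: smooth_differentiable (gmx_smooth g i) _; exists p.
have dh : differentiable h (chart i p).
  exact: differentiable_mulmx (differentiable_mulmx (differentiable_trmx dE) dG)
    dE'.
have h0E : h (chart i p) = h0 by rewrite /h /Em /Gm /Em' /= chartK.
have [hh ee'] := frame_change he he' Wp Wp' dp.
rewrite -/h0 in hh ee'.
(* The relation e' = e h holds near the point, so it can be differentiated. *)
have derE v : 'D_v Em' (chart i p) = 'D_v Em (chart i p) *m h0 + e i p
  *m 'D_v h (chart i p).
  have -> : 'D_v Em' (chart i p) = 'D_v (fun y => Em y *m h y) (chart i p).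
    by apply: near_eq_derive; apply: filterS nO => y /hO[].
  by rewrite (derive_mulmx v dE dh) h0E /Em /= chartK.
have lie v : h0^T *m 'D_v h (chart i p) \in spin9 I.
  by rewrite -h0E; apply: Spin9_derive => //; apply: filterS nO => y /hO[].
have inv' : invmx (e' i p) = h0^T *m invmx (e i p).
  rewrite (frame_invE he' Wp' dp) ee' trmx_mul (frame_invE he Wp dp).
  by rewrite !mulmxA.
have conn v : connform D e' i p v
    = h0^T *m connform D e i p v *m h0 + h0^T *m 'D_v h (chart i p).
  rewrite /connform inv' !nablaE -[dchart i (e' i) p v]/('D_v Em' (chart i p)).
  rewrite -[dchart i (e i) p v]/('D_v Em (chart i p)) derE ee'.
  rewrite !mulmxDr !mulmxDl -!mulmxA (mulKmx (frame_unit he Wp dp)) !mulmxA.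
  by rewrite addrAC.
apply/lfunP => x; rewrite spin9_actE trmxK.
rewrite (Gamma_E I D x hf' Wp' dp) (Gamma_E I D _ hf Wp dp) conn linearD /=.
rewrite (pr_m_spin9 hI (lie _)) addr0 ee' -mulmxA.
have := pr_m_Ad hI (Spin9_tr hh)
  (connform_skew he Wp dp (e i p *m (h0 *m x)) hD).
by rewrite trmxK -!mulmxA.
Qed.

End Gauge.

(** * Correcting the Levi-Civita connection *)

Section Correction.
Context {R : realType} (M : oriented_manifold R) (g : metric M).
Context (I : 'I_9 -> 'M[R]_16) (hI : spin9_generators I)
  (S : spin9_structure g I).
Context (LC : connection M) (hLC : levi_civita g LC).
Local Notation E := 'cV[R]_16.
Implicit Types (W : set M) (e : idx M -> M -> 'M[R]_16).

Definition frame_hom e i p : @homtype R := Theta_inv I (Gamma I LC e i p).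

(** The inverse of an orthonormal frame, in a form that depends polynomially on
    the frame and the metric. *)
Definition coframe e (i : idx M) p : 'M[R]_16 := (e i p)^T *m gmx g i p.

(** The endomorphism of the tangent space that the 3-form encoded by [frame_hom]
    attaches to v, transported from the model space by the frame. Subtracting it
    from the Christoffel symbols removes the m-part of the connection form. *)
Definition frame_corr e i p (v : E) : 'M[R]_16 :=
  e i p *m frame_hom e i p (coframe e i p *m v) *m coframe e i p.

Lemma frame_hom_alternating e i p : alternating3 (frame_hom e i p).
Proof. exact: Theta_inv_alternating. Qed.

Lemma coframeK W e i p k (A : 'M[R]_(16, k)) : adapted_frame S W e -> W p ->
  dom i p ->
  coframe e i p *m (e i p *m A) = A.
Proof.
by move=> he Wp dp; rewrite mulmxA (frame_orthonormal he Wp dp) mul1mx.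
Qed.

Lemma coframeVK W e i p k (A : 'M[R]_(16, k)) : adapted_frame S W e -> W p ->
  dom i p ->
  e i p *m (coframe e i p *m A) = A.
Proof.
move=> he Wp dp; rewrite /coframe -(frame_invE he Wp dp).
exact: mulKVmx (frame_unit he Wp dp) A.
Qed.

(** The frame and the value of Gamma are both independent of the chart. *)
Lemma frame_corr_trans W e i j p v : adapted_frame S W e -> W p -> dom i p ->
  dom j p ->
  frame_corr e j p (trans i j p *m v) *m trans i j p = trans i j p
    *m frame_corr e i p v.
Proof.
move=> he Wp di dj; have [oW hf _] := he.
have ej : e j p = trans i j p *m e i p by case: hf => h _; exact: h.
have ff : coframe e j p *m trans i j p = coframe e i p.
  have u := frame_unit he Wp di.
  rewrite -[LHS]mulmx1 -(mulmxV u) mulmxA -[_ *m _ *m e i p]mulmxA -ej.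
  by rewrite /coframe -[_ *m e j p]mulmxA mulmxA (frame_orthonormal he Wp dj)
    mul1mx (frame_invE he Wp di).
have GE : Gamma I LC e j p = Gamma I LC e i p.
  apply/lfunP => x; rewrite (Gamma_E I LC x hf Wp di) (Gamma_E I LC x hf Wp dj)
    ej.
  by rewrite -mulmxA (connform_trans LC _ oW hf Wp di dj (frame_unit he Wp di)).
by rewrite /frame_corr /frame_hom GE mulmxA ff -mulmxA ff ej -!mulmxA.
Qed.

Lemma frame_corr_linear e i p : linear (frame_corr e i p).
Proof.
move=> k x y; rewrite /frame_corr mulmxDr -scalemxAr linearP.
by rewrite mulmxDr mulmxDl -scalemxAr -scalemxAl.
Qed.

(** In the chart, Gamma is the m-part of e^T g times a sum of products of e, its
    partial derivatives and the Christoffel symbols; the correction is then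
    obtained from it by linear maps and matrix products. *)
Lemma frame_corr_smooth W e i (v : E) : adapted_frame S W e ->
  smooth_in i W (fun p => frame_corr e i p v).
Proof.
move=> he; have [oW hfW _] := he; have [_ hf] := hfW;
  have oU := chart_img_open (i := i) oW.
set U := chart i @` _ in oU.
have sE : smooth_on U (e i \o cinv i) by exact: hf.
have sG : smooth_on U (gmx g i \o cinv i).
  by apply: smooth_sub (gmx_smooth g i) => y [p [_ dp] <-]; exists p.
have sC c : smooth_on U ((fun p => christoffel LC i p c) \o cinv i).
  by apply: smooth_sub (christoffel_smooth LC i c) => y [p [_ dp] <-]; exists p.
have sF : smooth_on U (coframe e i \o cinv i).
  exact: smooth_mulmx oU (smooth_trmx oU sE) sG.
have sGamma q : smooth_on U (fun y => Gamma I LC e i (cinv i y) (basis q)).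
  (* The direction of derivation depends on the point, so it is expanded in the
     coordinate directions. *)
  pose N y := \sum_(c < 16) (e i (cinv i y) *m basis q) c 0 *:
    ('D_(basis c) (e i \o cinv i) y + christoffel LC i (cinv i y) c
      *m e i (cinv i y)).
  apply: (@smooth_ext _ _ U (fun y => pr_m I (coframe e i (cinv i y) *m N y)))
    => //.
    move=> y /chart_imgP[Wy dy cy].
    rewrite (Gamma_E I LC _ hfW Wy dy) /connform (frame_invE he Wy dy) nablaE.
    congr (pr_m I (_ *m _)); rewrite /N /dchart cy.
    rewrite (derive_basis (f := e i \o cinv i)); last first.
      by rewrite -cy; exact: (fields_differentiable (k := 15%N) hfW Wy dy).
    rewrite /christoffel_along mulmx_suml -big_split; apply: eq_bigr => c _.
    by rewrite scalerDr scalemxAl.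
  apply: smooth_lfun => //; apply: smooth_mulmx => //.
  apply: smooth_sum => // c.
  apply: (@smooth_ext _ _ U (fun y => (e i (cinv i y) *m basis q) c 0 *:
      'D_(basis c) (e i \o cinv i) y + (e i (cinv i y) *m basis q) c 0 *:
     (christoffel LC i (cinv i y) c *m e i (cinv i y)))) => //.
    by move=> y _; rewrite scalerDr.
  have sEq : smooth_on U (fun y => (e i (cinv i y) *m basis q) c 0 : R^o).
    by apply: (smooth_entry c 0 oU); apply: smooth_mulmx => //;
      exact: smooth_cst.
  have sZ (A : E -> 'M[R]_16) : smooth_on U A ->
      smooth_on U (fun y => (e i (cinv i y) *m basis q) c 0 *: A y).
    move=> sA; apply: smooth_mx => // a b.
    apply: smooth_ext (smooth_mul oU sEq (smooth_entry a b oU sA)) => // y _.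
    by rewrite [RHS]mxE.
  apply: smooth_add => //; apply: sZ; first exact: smooth_derive.
  by apply: smooth_mulmx => //; exact: sC.
have sH q : smooth_on U (fun y => frame_hom e i (cinv i y) (basis q)).
  exact: smooth_hom_lfun.
apply: (@smooth_mulmx _ U _ _ _
  (fun y => e i (cinv i y) *m frame_hom e i (cinv i y)
  (coframe e i (cinv i y) *m v))) => //.
apply: smooth_mulmx => //; apply: smooth_hom_apply => //.
by apply: smooth_mulmx => //; exact: smooth_cst.
Qed.

Context (P : splitting I) (hG : Gamma_part03_vanishes S P LC).

Lemma Gamma_in_img W e i p : adapted_frame S W e -> W p -> dom i p ->
  Gamma I LC e i p \in Theta_img I.
Proof.
move=> he Wp dp; have [_ hf _] := he; apply/(part03_eq0 P hI) => [x|].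
  by rewrite (Gamma_E I LC x hf Wp dp) mem_pr_m.
exact: hG he _ _ Wp dp.
Qed.

Lemma Theta_frame_hom W e i p : adapted_frame S W e -> W p -> dom i p ->
  Theta I (frame_hom e i p) = Gamma I LC e i p.
Proof. by move=> he Wp dp; apply: Theta_invK; apply: Gamma_in_img he Wp dp. Qed.

(** By injectivity, the equivariance of Theta carries over to its inverse:
    replacing e by e h conjugates [frame_hom] by h, which the change of frame
    undoes. *)
Lemma frame_corr_gauge W W' e e' i p v : adapted_frame S W e ->
  adapted_frame S W' e' ->
  W p -> W' p -> dom i p -> frame_corr e' i p v = frame_corr e i p v.
Proof.
move=> he he' Wp Wp' dp; case: hLC => hmet _.
have [hh e'E] := frame_change he he' Wp Wp' dp.
have Gg := Gamma_gauge hI hmet he he' Wp Wp' dp.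
set h := _ *m e' i p in hh e'E Gg; rewrite /= in Gg; clearbody h.
have homE : frame_hom e' i p = spin9_act h^T (frame_hom e i p).
  have ha := frame_hom_alternating.
  apply: (Theta_inj hI (ha _ _ _));
    first exact: (alternating3_act (Spin9_tr hh) (ha _ _ _)).
  rewrite (Theta_act hI (Spin9_tr hh) (ha _ _ _)) (Theta_frame_hom he Wp dp).
  by rewrite (Theta_frame_hom he' Wp' dp).
have cE : coframe e' i p = h^T *m coframe e i p.
  by rewrite /coframe e'E trmx_mul mulmxA.
rewrite /frame_corr homE spin9_actE trmxK cE e'E.
have hht (A : 'M[R]_(16, 1)) :
  h *m (h^T *m A) = A by rewrite mulmxA (Spin9_trr hh) mul1mx.
have hht' (A : 'M[R]_16) : h *m (h^T *m A) = A
  by rewrite mulmxA (Spin9_trr hh) mul1mx.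
move: (coframe e i p) => f; by rewrite -!mulmxA hht !hht'.
Qed.

(** K is defined at each point by all the adapted frames at that point at once;
    the independence of the frame shows that such a K exists, and each property
    of K can then be checked in a convenient frame. *)
Definition is_correction (K : idx M -> M -> E -> 'M[R]_16) : Prop :=
  forall W e i p v, adapted_frame S W e -> W p -> dom i p ->
    K i p v = frame_corr e i p v.

Lemma exists_correction : exists K, is_correction K.
Proof.
have /choice[w hw] : forall p, exists We : set M * (idx M -> M -> 'M[R]_16),
    adapted_frame S We.1 We.2 /\ We.1 p.
  by move=> p; have [W [e he]] := adapted_frame_at S p; exists (W, e).
exists (fun i p v => frame_corr (w p).2 i p v) => W e i p v he Wp dp.
by have [he' Wp'] := hw p; apply: frame_corr_gauge he he' Wp Wp' dp.
Qed.
End Correction.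

Section CorrectedConnection.
Context {R : realType} (M : oriented_manifold R) (g : metric M).
Context (I : 'I_9 -> 'M[R]_16) (hI : spin9_generators I)
  (S : spin9_structure g I).
Context (LC : connection M) (hLC : levi_civita g LC).
Context (P : splitting I) (hG : Gamma_part03_vanishes S P LC).
Local Notation E := 'cV[R]_16.
Context (K : idx M -> M -> E -> 'M[R]_16) (hK : is_correction S LC K).
Implicit Types (W : set M) (e : idx M -> M -> 'M[R]_16).

Definition correction_form : three_tensor M :=
  fun i p x y z => gdot g i p (K i p z *m x) y.

Lemma correction_linear i p : dom i p -> linear (K i p).
Proof.
move=> dp k x y; have [W [e [he Wp]]] := adapted_frame_at S p.
by rewrite !(hK _ he Wp dp) frame_corr_linear.
Qed.

Lemma correction_trans i j p v : dom i p -> dom j p ->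
  K j p (trans i j p *m v) *m trans i j p = trans i j p *m K i p v.
Proof.
move=> di dj; have [W [e [he Wp]]] := adapted_frame_at S p.
rewrite (hK _ he Wp di) (hK _ he Wp dj); exact: frame_corr_trans he Wp di dj.
Qed.

Lemma correction_smooth i v : smooth_in i (dom i) (fun p => K i p v).
Proof.
apply: smooth_local => y /chart_imgP[_ dy cy].
have [W [e [he Wy]]] := adapted_frame_at S (cinv i y); have [oW _ _] := he.
exists (chart i @` (W `&` dom i)); split; first by exists (cinv i y).
have := frame_corr_smooth LC i v he; apply: smooth_ext => [|z].
  exact: chart_img_open.
by move=> /chart_imgP[Wz dz _]; rewrite /= (hK _ he Wz dz).
Qed.

Lemma correction_form_frame W e i p x y z : adapted_frame S W e -> W p ->
  dom i p ->
  correction_form i p (e i p *m x) (e i p *m y) (e i p *m z)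
  = dotmx (frame_hom I LC e i p z *m x) y.
Proof.
move=> he Wp dp; rewrite /correction_form (hK _ he Wp dp) /frame_corr.
rewrite -mulmxA (coframeK x he Wp dp) (coframeK z he Wp dp) -mulmxA.
exact: gdot_frame he Wp dp _ _.
Qed.

Lemma coframe_ex i p : dom i p -> exists W e,
  [/\ adapted_frame S W e, W p & forall x, e i p *m (coframe g e i p *m x)
    = x :> E].
Proof.
move=> dp; have [W [e [he Wp]]] := adapted_frame_at S p.
by exists W, e; split=> // x; exact: (coframeVK x he Wp dp).
Qed.

(** Antisymmetry is read in a frame. Invariance and smoothness are those of K
    and of g, as the form is obtained from K by lowering an index. *)
Lemma correction_three_form : three_form correction_form.
Proof.
split.
- move=> i p dp; have [W [e [he Wp hx]]] := coframe_ex dp.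
  have [h1 h2] := frame_hom_alternating I LC e i p.
  have fE x y z := correction_form_frame (coframe g e i p *m x)
    (coframe g e i p *m y)
    (coframe g e i p *m z) he Wp dp.
  split=> [r x x' y z|x y z|x y z].
  + rewrite /correction_form /gdot mulmxDr -scalemxAr linearD linearZ /=.
    by rewrite !mulmxDl -!scalemxAl !mxE.
  + have := fE y x z; have := fE x y z; rewrite !hx => -> ->.
    exact: dotmx_skew.
  + have := fE x z y; have := fE x y z; rewrite !hx => -> ->.
    rewrite (h2 (coframe g e i p *m y)) dotmxNl (dotmx_skew _ _ (h1 _)) opprK.
    by rewrite (h2 (coframe g e i p *m x)) dotmxNl.
- move=> i j p di dj x y z; rewrite /correction_form.
  rewrite mulmxA (correction_trans z di dj) -mulmxA /gdot (gmx_trans g di dj).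
  by rewrite !trmx_mul !mulmxA.
- move=> i a b c.
  have oU : open (chart i @` (dom i `&` dom i)) by apply: chart_img_open;
    exact: dom_open.
  have sK := correction_smooth i (basis c); have sG := gmx_smooth g i.
  have := smooth_entry a b oU (smooth_mulmx oU (smooth_trmx oU sK) sG).
  apply: smooth_ext => // y _.
  have eAG (A G : 'M[R]_16) : ((A *m basis a)^T *m G *m basis b) 0 0
    = (A^T *m G) a b.
    by rewrite /basis trmx_mul trmx_delta -!mulmxA -rowE !mulmxA -colE !mxE.
  exact/esym/eAG.
Qed.

Lemma correction_Gamma : Gamma_is S LC correction_form.
Proof.
move=> W e he i p Wp dp x.
have [h1 h2] := frame_hom_alternating I LC e i p.
rewrite (embed3_pr_m hI (gam := frame_hom I LC e i p)) //.
  by rewrite -ThetaE (Theta_frame_hom hI hG he Wp dp).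
by move=> a b; exact: (correction_form_frame (basis a) (basis b) x he Wp dp).
Qed.

Definition corrected_christoffel (i : idx M) p (c : 'I_16) : 'M[R]_16 :=
  christoffel LC i p c - K i p (basis c).

Lemma corrected_christoffel_along i p (v : E) : dom i p ->
  \sum_(c < 16) v c 0 *: corrected_christoffel i p c
    = christoffel_along LC i p v - K i p v.
Proof.
move=> dp; under eq_bigr => c _ do rewrite scalerBr.
rewrite sumrB; congr (_ - _).
pose L : {linear E -> 'M[R]_16} :=
  HB.pack (K i p) (GRing.isLinear.Build _ _ _ _ (K i p) (correction_linear dp)).
rewrite [in RHS](sum_basis v) -[RHS]/(L _) linear_sum.
by apply: eq_bigr => c _; rewrite linearZ.
Qed.

Lemma corrected_christoffel_smooth i c :
  smooth_in i (dom i) (fun p => corrected_christoffel i p c).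
Proof.
have oU : open (chart i @` (dom i `&` dom i)) by apply: chart_img_open;
  exact: dom_open.
apply: smooth_ext (smooth_add oU (christoffel_smooth LC i c)
  (smooth_mulmx oU (smooth_cst _ (- 1%:M)) (correction_smooth i (basis c))))
    => // y _.
by rewrite /= mulNmx mul1mx.
Qed.

Lemma corrected_covd_trans W (X : idx M -> M -> E) : open W ->
  vector_field W X ->
  forall i j p (v : E), W p -> dom i p -> dom j p ->
    @covd _ _ corrected_christoffel 0 j X p (trans i j p *m v)
      = trans i j p *m @covd _ _ corrected_christoffel 0 i X p v.
Proof.
move=> oW hX i j p v Wp di dj.
have h := covd_trans LC oW hX v Wp di dj.
rewrite /covd !corrected_christoffel_along // !mulmxBl mulmxDr mulmxBr !addrA.
have -> : X j p = trans i j p *m X i p by case: hX => h' _; exact: h'.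
rewrite [in X in _ - X]mulmxA (correction_trans v di dj) -mulmxA; congr (_ - _).
move: h; rewrite /covd mulmxDr.
by have -> : X j p = trans i j p *m X i p by case: hX => h' _; exact: h'.
Qed.

Definition corrected_connection : connection M :=
  Connection corrected_christoffel_smooth corrected_covd_trans.

Lemma corrected_along i p v : dom i p ->
  christoffel_along corrected_connection i p v = christoffel_along LC i p v
    - K i p v.
Proof. exact: corrected_christoffel_along. Qed.

(** In a frame, the connection form loses exactly the values of [frame_hom],
    whose m-part is Gamma, the m-part of the Levi-Civita form. *)
Lemma corrected_preserves : preserves S corrected_connection.
Proof.
move=> W e he i p v Wp dp; have [oW hf _] := he; have [hmet _] := hLC.
have [h1 _] := frame_hom_alternating I LC e i p.
have u := frame_unit he Wp dp.
set f := coframe g e i p.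
have fe : f *m e i p = 1%:M := frame_orthonormal he Wp dp.
have cE : connform corrected_connection e i p v
    = connform LC e i p v - frame_hom I LC e i p (f *m v).
  rewrite /connform !nablaE (corrected_along v dp) (hK _ he Wp dp) /frame_corr
    mulmxBl addrA.
  rewrite mulmxBr; congr (_ - _).
  rewrite -/f; move: (f) fe => f0 fe0.
  by rewrite -!mulmxA (mulKmx u) fe0 mulmx1.
have skLC := connform_skew he Wp dp v hmet.
apply: pr_m_eq0 => //; rewrite cE.
  by rewrite linearB /= skLC h1 opprB opprK addrC.
rewrite linearB /= -ThetaE (Theta_frame_hom hI hG he Wp dp)
  (Gamma_E I LC _ hf Wp dp).
by rewrite (coframeVK v he Wp dp) subrr.
Qed.

(** The torsion is - K(X) Y + K(Y) X, and each of the two terms contributes - mu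
    by antisymmetry. *)
Lemma corrected_torsion : torsion_form g corrected_connection
  (fun i p x y z => - 2 * correction_form i p x y z).
Proof.
move=> W X Y Z oW hX hY hZ i p Wp dp; have [_ htf] := hLC.
rewrite (torsion_diff _ htf oW hX hY Wp dp) !(corrected_along _ dp).
have aux (a b : 'M[R]_16) : a - b - a = - b by rewrite addrAC subrr sub0r.
rewrite !aux; have [h3 _ _] := correction_three_form;
  have [_ s1 s2] := h3 i p dp.
have gE (A B : 'M[R]_16) : gdot g i p (- A *m Y i p - - B *m X i p) (Z i p)
    = - gdot g i p (A *m Y i p) (Z i p) + gdot g i p (B *m X i p) (Z i p).
  by rewrite /gdot !mulNmx opprK linearD linearN /= !mulmxDl !mulNmx !mxE.
rewrite gE -!/(correction_form i p _ _ _).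
rewrite (s2 (Y i p) (X i p) (Z i p)) (s1 (X i p) (Y i p) (Z i p))
  (s2 (X i p) (Y i p) (Z i p)).
by ring.
Qed.

Lemma corrected_skew_torsion : skew_torsion g corrected_connection.
Proof.
exists (fun i p x y z => - 2 * correction_form i p x y z); split.
  exact: three_formZ correction_three_form.
exact: corrected_torsion.
Qed.
End CorrectedConnection.

(** * The characterization *)

Section MainTheorem.
Context {R : realType} (M : oriented_manifold R) (g : metric M).
Context (I : 'I_9 -> 'M[R]_16) (hI : spin9_generators I)
  (S : spin9_structure g I).
Context (LC : connection M) (hLC : levi_civita g LC) (P : splitting I).
Local Notation E := 'cV[R]_16.

Lemma Gamma_part03_of_connection D : preserves S D -> skew_torsion g D ->
  Gamma_part03_vanishes S P LC.
Proof.
move=> hD [T [hT htor]] W e he i p Wp dp; have [_ hf _] := he.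
have [ka _ kG] := skew_torsion_frame hI hD hT htor hLC he Wp dp.
apply/(part03_eq0 P hI) => [x|].
  by rewrite (Gamma_E I LC x hf Wp dp) mem_pr_m.
rewrite -[Gamma _ _ _ _ _]opprK -kG memvN; apply/(mem_Theta_img I).
by exists (frame_diff D LC e i p).
Qed.

(** In a frame, both differences with the Levi-Civita connection are mapped by
    Theta to - Gamma. *)
Lemma skew_connection_unique D D' : preserves S D -> skew_torsion g D ->
  preserves S D' -> skew_torsion g D' -> same_connection D D'.
Proof.
move=> hD [T [hT htor]] hD' [T' [hT' htor']] W Y oW hY i p v Wp dp.
have [W1 [e [he Wp1]]] := adapted_frame_at S p.
have [ka _ kG] := skew_torsion_frame hI hD hT htor hLC he Wp1 dp.
have [ka' _ kG'] := skew_torsion_frame hI hD' hT' htor' hLC he Wp1 dp.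
have kk : frame_diff D LC e i p = frame_diff D' LC e i p.
  by apply: (Theta_inj hI ka ka'); rewrite kG kG'.
have m1 := mul_frame_diff D LC (coframe g e i p *m v) he Wp1 dp.
have m2 := mul_frame_diff D' LC (coframe g e i p *m v) he Wp1 dp.
rewrite (coframeVK v he Wp1 dp) in m1 m2.
have : (christoffel_along D i p v - christoffel_along LC i p v) *m e i p =
       (christoffel_along D' i p v - christoffel_along LC i p v) *m e i p.
  by rewrite -m1 -m2 kk.
move/(can_inj (mulmxK (frame_unit he Wp1 dp))) => /addIr eK.
by rewrite !nablaE eK.
Qed.

(** In a frame, the difference of D and LC is - [frame_hom] by injectivity of
    Theta, while the torsion is twice this difference. *)
Lemma skew_torsion_form (K : idx M -> M -> E -> 'M[R]_16) D :
  Gamma_part03_vanishes S P LC -> is_correction S LC K ->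
  preserves S D -> skew_torsion g D ->
  torsion_form g D (fun i p x y z => - 2 * correction_form g K i p x y z).
Proof.
move=> hG hK hD [T [hT htor]] W X Y Z oW hX hY hZ i p Wp dp.
rewrite -(htor W X Y Z oW hX hY hZ i p Wp dp).
have [W1 [e [he Wp1]]] := adapted_frame_at S p.
have [ka kT kG] := skew_torsion_frame hI hD hT htor hLC he Wp1 dp.
have ha := frame_hom_alternating I LC e i p.
have kk : frame_diff D LC e i p = - frame_hom I LC e i p.
  have han : alternating3 (0 - frame_hom I LC e i p).
    apply: alternating3B ha; split=> [x|x y]; rewrite !zero_lfunE.
      by rewrite linear0 oppr0.
    by rewrite !mul0mx oppr0.
  rewrite -[RHS]add0r; apply: (Theta_inj hI ka han); rewrite kG.
  rewrite -(Theta_frame_hom hI hG he Wp1 dp); apply/lfunP => x.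
  by rewrite opp_lfunE !ThetaE add_lfunE zero_lfunE opp_lfunE add0r linearN.
rewrite -(coframeVK (X i p) he Wp1 dp) -(coframeVK (Y i p) he Wp1 dp)
  -(coframeVK (Z i p) he Wp1 dp).
rewrite kT (correction_form_frame hK _ _ _ he Wp1 dp) kk opp_lfunE mulNmx
  dotmxNl.
have [h1 h2] := ha.
by rewrite (h2 (coframe g e i p *m Z i p)) dotmxNl (dotmx_skew _ _ (h1 _));
  ring.
Qed.
End MainTheorem.

Theorem theorem3p1 (R : realType) (M : oriented_manifold R) (g : metric M)
    (I : 'I_9 -> 'M[R]_16) (hI : spin9_generators I) (P : splitting I)
    (S : spin9_structure g I) (LC : connection M) (hLC : levi_civita g LC) :
  ((exists D : connection M, preserves S D /\ skew_torsion g D) <->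
   Gamma_part03_vanishes S P LC)
  /\
  (Gamma_part03_vanishes S P LC ->
   exists mu : three_tensor M,
     [/\ three_form mu,
         Gamma_is S LC mu,
         forall D D' : connection M,
           preserves S D -> skew_torsion g D ->
           preserves S D' -> skew_torsion g D' -> same_connection D D'
       & forall D : connection M, preserves S D -> skew_torsion g D ->
           torsion_form g D (fun i p x y z => - 2 * mu i p x y z)]).
Proof.
split.
  split=> [[D [hD ht]]|hG]; first exact: Gamma_part03_of_connection hD ht.
  have [K hK] := exists_correction hI hLC hG.
  exists (corrected_connection hK); split.
    exact: (corrected_preserves hI hLC hG hK).
  exact: (corrected_skew_torsion hLC hK).
move=> hG; have [K hK] := exists_correction hI hLC hG.
exists (correction_form g K); split.
- exact: correction_three_form hK.
- exact: (correction_Gamma hI hG hK).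
- by move=> D D'; exact: (skew_connection_unique hI hLC).
- by move=> D hD ht; exact: (skew_torsion_form hI hLC hG hK hD ht).
Qed.
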